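(* For every constant $c_*>0$ there exists a constant $c_1>0$ such that the following holds. Let $k=k(n)\ge 1$ be integers with $k\le c_1\, n^{1/3}/\log n$. Let $T(G)=1$ if $\mathsf{Val}(G;4)>c_*k$ and $T(G)=0$ if $\mathsf{Val}(G;4)\le c_*k$. Then $\mathbb{P}\{T(G)=1\}\to1$ as $n\to\infty$ both when $G\sim\mathbb{G}(n,1/2)$ and when $G\sim\mathbb{G}(n,1/2,k)$. In particular the degree-$4$ Sum-of-Squares test $T$ fails to distinguish with high probability between the two models.
   Context: $[n]=\{1,\dots,n\}$; $\binom{[n]}{\le 2}$ is the set of subsets of $[n]$ of size at most $2$ (including $\emptyset$). $\mathbb{G}(n,p)$ is the Erdős–Rényi random graph on $[n]$ with edge probability $p$. $\mathbb{G}(n,p,k)$ is the hidden clique model: a uniformly random subset of $k$ vertices of $[n]$ forms a clique, and every other edge is present independently with probability $p$. For a graph $G$ on $[n]$, $\mathsf{Val}(G;4)$ is the value of the degree-$4$ SOS relaxation of maximum clique: the maximum of $\sum_{i\in[n]}X_{\{i\},\{i\}}$ over symmetric real matrices $X$ indexed by $\binom{[n]}{\le 2}\times\binom{[n]}{\le 2}$ such that $X\succeq0$; all $X_{S_1,S_2}\in[0,1]$; $X_{S_1,S_2}=0$ whenever $S_1\cup S_2$ is not a clique in $G$ (sets of size at most $1$ are cliques); $X_{S_1,S_2}=X_{S_3,S_4}$ whenever $S_1\cup S_2=S_3\cup S_4$; and $X_{\emptyset,\emptyset}=1$. *)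

(* Defs.v *)
From HB Require Import structures.
From mathcomp Require Import all_boot all_order all_algebra.
From mathcomp Require Import all_classical all_reals all_analysis.
Set Implicit Arguments.
Unset Strict Implicit.
Unset Printing Implicit Defensive.
Import Order.TTheory GRing.Theory Num.Theory.
Import numFieldNormedType.Exports.
Local Open Scope classical_set_scope.
Local Open Scope ring_scope.

(* MathComp / MathComp-Analysis; the vertex set {1, .., n} is 'I_n.           *)

Definition edge (n : nat) := {e : {set 'I_n} | #|e| == 2}.

(* A simple graph on 'I_n is its set of edges.                                *)
Definition graph (n : nat) := {set edge n}.

Definition is_clique (n : nat) (G : graph n) (S : {set 'I_n}) : bool :=
  [forall e : edge n, (val e \subset S) ==> (e \in G)].

Definition prob (R : realType) (n : nat) (mu : graph n -> R)
    (A : pred (graph n)) : R :=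
  \sum_(G | A G) mu G.

Definition erdos_renyi (R : realType) (n : nat) (p : R) (G : graph n) : R :=
  \prod_(e : edge n) (if e \in G then p else 1 - p).

(* Law of the graph given that K is the planted clique.                       *)
Definition planted_on (R : realType) (n : nat) (p : R) (K : {set 'I_n})
    (G : graph n) : R :=
  \prod_(e : edge n)
    (if val e \subset K then (e \in G)%:R
     else if e \in G then p else 1 - p).

(* For k > n there is no k-subset, and this is the zero function.             *)
Definition hidden_clique (R : realType) (n : nat) (p : R) (k : nat)
    (G : graph n) : R :=
  \sum_(K : {set 'I_n} | #|K| == k) 'C(n, k)%:R^-1 * planted_on p K G.

Definition small (n : nat) := {S : {set 'I_n} | (#|S| <= 2)%N}.

Fact small0_subproof (n : nat) : (#|(finset.set0 : {set 'I_n})| <= 2)%N.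
Proof. by rewrite cards0. Qed.

Fact small1_subproof (n : nat) (i : 'I_n) : (#|[set i]%SET| <= 2)%N.
Proof. by rewrite cards1. Qed.

Definition small0 (n : nat) : small n := Sub finset.set0 (small0_subproof n).

Definition small1 (n : nat) (i : 'I_n) : small n :=
  Sub [set i]%SET (small1_subproof i).

Definition psdmx (R : realType) (m : nat) (A : 'M[R]_m) : Prop :=
  A^T = A /\ forall v : 'cV[R]_m, 0 <= (v^T *m A *m v) 0 0.

Definition entry (R : realType) (n : nat) (X : 'M[R]_#|{: small n}|)
    (S T : small n) : R :=
  X (enum_rank S) (enum_rank T).

Definition sos4_feasible (R : realType) (n : nat) (G : graph n)
    (X : 'M[R]_#|{: small n}|) : Prop :=
  [/\ psdmx X,
      forall S T, 0 <= entry X S T <= 1,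
      forall S T, ~~ is_clique G (val S :|: val T)%SET -> entry X S T = 0,
      forall S1 S2 S3 S4 : small n,
        (val S1 :|: val S2 = val S3 :|: val S4)%SET ->
        entry X S1 S2 = entry X S3 S4
    & entry X (small0 n) (small0 n) = 1].

Definition sos4_objective (R : realType) (n : nat)
    (X : 'M[R]_#|{: small n}|) : R :=
  \sum_(i < n) entry X (small1 i) (small1 i).

Definition sos4_values (R : realType) (n : nat) (G : graph n) : set R :=
  [set sos4_objective X | X in [set X | sos4_feasible G X]].

(* The feasible set is compact and nonempty, so this supremum is a maximum.   *)
Definition Val4 (R : realType) (n : nat) (G : graph n) : R :=
  sup (sos4_values (R := R) G).

(* T = 1 is encoded as true.                                                  *)
Definition sos4_test (R : realType) (c : R) (k : nat) (n : nat)
    (G : graph n) : bool :=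
  c * k%:R < Val4 R G.

(* Both error probabilities of the test vanish asymptotically; true is the    *)
(* decision in favour of the hidden clique model.                             *)
Definition distinguishes_whp (R : realType) (p : R) (k : nat -> nat)
    (T : forall n, graph n -> bool) : Prop :=
  (prob (@erdos_renyi R n p) (@T n) @[n --> \oo] --> (0 : R)) /\
  (prob (@hidden_clique R n p (k n)) (predC (@T n)) @[n --> \oo] --> (0 : R)).

(* Main.v *)
(** The witness is the pseudo-moment matrix
    [X_{S,T} = a_{|S u T|} 1{S u T is a clique}] with [a_1 = kappa] equal to
    [n^(-2/3) / ln n], whose objective is [n kappa = n^(1/3) / ln n].

    With [A] the +-1 adjacency matrix (1 on the diagonal), clique indicators are
    products of factors [(1 + A)/2]; expanding them turns the quadratic form of
    [X] at a vector with vertex part [x] and edge part [f] into a form that is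
    positive in [x], [f] and the row sums [G] of [f], plus errors governed by
    the norms of [A], of [f |-> diag (A f A)], and of the matrix of 4-cycles
    [A_ik A_il A_jk A_jl].  The worst errors pair [diag (A f A)] with [x] or
    [G]; they are absorbed because [a_3] contributes a term [kappa^3 |G|^2],
    and this is where [kappa^3 n^2 -> 0] is needed.

    The logarithmic slack makes sixth moments sufficient: for symmetric [K],
    [|K x|^6 <= ||K^3||_F^2 |x|^6], and [E ||K^3||_F^2] counts closed walks of
    length 6 in which every edge of the graph is used an even number of times
    (for [diag (A f A)], a fourth moment of the codegrees plays this role).
    A vertex occurring only once in such a walk forces its two neighbouring
    positions to coincide, so such a walk visits few vertices.

    Since feasibility is monotone in the graph and the planted model is the
    uniform one with extra edges, the event transfers to the planted model. *)
Require Import Defs.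
From HB Require Import structures.
From mathcomp Require Import all_boot all_order all_algebra.
From mathcomp Require Import all_classical all_reals all_analysis.
From mathcomp Require Import ring lra zify.
Set Implicit Arguments.
Unset Strict Implicit.
Unset Printing Implicit Defensive.
Import Order.TTheory GRing.Theory Num.Theory.
Import numFieldNormedType.Exports.
Local Open Scope classical_set_scope.
Local Open Scope ring_scope.
(** * Operator norms from walk sums *)

Section SumsOfSquares.
Variable R : realFieldType.

Lemma sum_sqr_ge0 (I : finType) (x : I -> R) : 0 <= \sum_i x i ^+ 2.
Proof. by apply: sumr_ge0 => i _; exact: sqr_ge0. Qed.

(** Weighted AM-GM, from the square of [x i + s^-1 * y i]. The weight [s] stays free so that each
    cross term can be charged to two squares of different sizes. *)
Lemma sum_mul_ge (I : finType) (s : R) (x y : I -> R) : 0 < s ->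
  - (s * (\sum_i x i ^+ 2) + s^-1 * (\sum_i y i ^+ 2)) <= 2 * \sum_i x i * y i.
Proof.
move=> s0; rewrite !mulr_sumr -big_split -sumrN; apply: ler_sum => i _ /=.
have -> : s^-1 * y i ^+ 2 = s * (s^-1 * y i) ^+ 2 by field; lra.
have -> : 2 * (x i * y i) = 2 * (s * (x i * (s^-1 * y i))) by field; lra.
have := mulr_ge0 (ltW s0) (sqr_ge0 (x i + s^-1 * y i)).
by set z := s^-1 * y i; nra.
Qed.

(** Lagrange's identity: the double sum of the squared 2 by 2 minors is twice the gap between the
    two sides. *)
Lemma cauchy_schwarz (I : finType) (x y : I -> R) :
  (\sum_i x i * y i) ^+ 2 <= (\sum_i x i ^+ 2) * (\sum_i y i ^+ 2).
Proof.
have : 0 <= \sum_i \sum_j (x i * y j - x j * y i) ^+ 2.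
  by apply: sumr_ge0 => i _; apply: sum_sqr_ge0.
have E i j : (x i * y j - x j * y i) ^+ 2 =
  x i ^+ 2 * y j ^+ 2 + (y i ^+ 2 * x j ^+ 2 - 2 * ((x i * y i) * (x j * y j))).
  by ring.
under eq_bigr do under eq_bigr do rewrite E.
under eq_bigr do rewrite big_split sumrB -!mulr_sumr.
rewrite big_split sumrB -!mulr_suml -!mulr_sumr -mulr_suml /=.
by rewrite expr2; nra.
Qed.

Section Operator.
Variables (T : finType) (K : T -> T -> R).
Hypothesis K_sym : forall i j, K i j = K j i.

Definition opr (x : T -> R) (i : T) : R := \sum_j K i j * x j.

(** The squared Frobenius norm of [K^3]; for symmetric [K] it is the trace of [K^6], hence a sum
    over closed walks of length 6. *)
Definition cube_frob : R := \sum_i \sum_j (\sum_k \sum_l K i k * K k l * K l j) ^+ 2.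

Lemma dot_opr (x y : T -> R) : \sum_i x i * opr y i = \sum_i opr x i * y i.
Proof.
rewrite /opr; under eq_bigr do rewrite mulr_sumr.
rewrite exchange_big; apply: eq_bigr => i _ /=; rewrite mulr_suml.
by apply: eq_bigr => j _; rewrite (K_sym j i); ring.
Qed.

Lemma opr3E x i :
  opr (opr (opr x)) i = \sum_j (\sum_k \sum_l K i k * K k l * K l j) * x j.
Proof.
rewrite /opr; under [RHS]eq_bigr do rewrite mulr_suml.
rewrite [RHS]exchange_big; apply: eq_bigr => k _ /=.
under [RHS]eq_bigr do rewrite mulr_suml.
rewrite [RHS]exchange_big mulr_sumr; apply: eq_bigr => l _ /=.
by rewrite mulrA mulr_sumr; apply: eq_bigr => j _; ring.
Qed.

(** Let [X], [a], [b], [c] be the squared norms of [x], [K x], [K^2 x], [K^3 x]. Symmetry of [K]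
    gives [a^2 <= X b] and [b^2 <= a c], and Cauchy-Schwarz on the rows of [K^3] gives
    [c <= cube_frob * X]. Hence [a^4 <= a * cube_frob * X^3], and one factor [a] cancels. *)
Lemma opr_norm_cube (x : T -> R) :
  (\sum_i opr x i ^+ 2) ^+ 3 <= cube_frob * (\sum_i x i ^+ 2) ^+ 3.
Proof.
set X := \sum_i x i ^+ 2; set a := \sum_i opr x i ^+ 2.
set z := opr (opr x); set b := \sum_i z i ^+ 2; set c := \sum_i opr z i ^+ 2.
have X0 : 0 <= X by exact: sum_sqr_ge0.
have a0 : 0 <= a by exact: sum_sqr_ge0.
have b0 : 0 <= b by exact: sum_sqr_ge0.
have c0 : 0 <= c by exact: sum_sqr_ge0.
have ab : a ^+ 2 <= X * b.
  have -> : a = \sum_i x i * z i by rewrite dot_opr.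
  exact: cauchy_schwarz.
have bc : b ^+ 2 <= a * c.
  have -> : b = \sum_i opr x i * opr z i by rewrite dot_opr.
  exact: cauchy_schwarz.
have cS : c <= cube_frob * X.
  rewrite /c /cube_frob mulr_suml; apply: ler_sum => i _.
  by rewrite /z opr3E; apply: cauchy_schwarz.
have [a_gt0|] := ltP 0 a; last first.
  move=> a_le0; have -> : a = 0 by lra.
  rewrite expr0n /= mulr_ge0 ?exprn_ge0 //.
  by apply: sumr_ge0 => i _; apply: sum_sqr_ge0.
have : a ^+ 4 <= X ^+ 2 * (a * (cube_frob * X)).
  apply: (@le_trans _ _ ((X * b) ^+ 2)).
    by rewrite (exprM _ 2 2) ler_pXn2r ?nnegrE ?mulr_ge0 ?exprn_ge0.
  rewrite exprMn ler_wpM2l ?exprn_ge0 //; apply: (le_trans bc).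
  by rewrite ler_wpM2l.
have -> : X ^+ 2 * (a * (cube_frob * X)) = a * (cube_frob * X ^+ 3) by ring.
by rewrite exprS ler_pM2l.
Qed.

Lemma opr_norm (h : R) (x : T -> R) : 0 <= h -> cube_frob <= h ^+ 6 ->
  \sum_i opr x i ^+ 2 <= h ^+ 2 * \sum_i x i ^+ 2.
Proof.
move=> h0 Sh; have X0 := sum_sqr_ge0 x.
rewrite -(@ler_pXn2r _ 3) ?nnegrE ?mulr_ge0 ?exprn_ge0 ?sum_sqr_ge0 //.
apply: (le_trans (opr_norm_cube x)).
by rewrite exprMn -exprM ler_wpM2r ?exprn_ge0.
Qed.

End Operator.

End SumsOfSquares.

(** * Positivity of the pseudo-moment form *)

Section QuadraticForm.
Variables (R : realFieldType) (T : finType) (A : T -> T -> R).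
Hypothesis A_sym : forall i j, A i j = A j i.
Hypothesis A_sqr : forall i j, A i j ^+ 2 = 1.
Variables (x : T -> R) (f : T -> T -> R).
Hypothesis f_sym : forall i j, f i j = f j i.
Variable W : T -> T -> R.
Hypothesis W_half : forall i j, W i j = (1 + A i j) / 2.

Let G i := \sum_j f i j.
Let beta k := \sum_i \sum_j f i j * (A i k * A j k).

Definition quad4 (F : T -> T -> T -> T -> R) : R :=
  \sum_i \sum_j \sum_k \sum_l f i j * f k l * F i j k l.

Lemma eq_quad4 F F' : (forall i j k l, F i j k l = F' i j k l) ->
  quad4 F = quad4 F'.
Proof.
move=> FF'; apply: eq_bigr => i _; apply: eq_bigr => j _; apply: eq_bigr => k _.
by apply: eq_bigr => l _; rewrite FF'.
Qed.

Lemma quad4D F F' : quad4 (fun i j k l => F i j k l + F' i j k l) =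
  quad4 F + quad4 F'.
Proof.
rewrite /quad4 -big_split; apply: eq_bigr => i _ /=.
rewrite -big_split; apply: eq_bigr => j _ /=.
rewrite -big_split; apply: eq_bigr => k _ /=.
by rewrite -big_split; apply: eq_bigr => l _ /=; rewrite mulrDr.
Qed.

Lemma quad4Z c F : quad4 (fun i j k l => c * F i j k l) = c * quad4 F.
Proof.
rewrite /quad4 mulr_sumr; apply: eq_bigr => i _ /=.
rewrite mulr_sumr; apply: eq_bigr => j _ /=.
rewrite mulr_sumr; apply: eq_bigr => k _ /=.
by rewrite mulr_sumr; apply: eq_bigr => l _ /=; rewrite mulrCA.
Qed.

Lemma quad4_swapl F : quad4 (fun i j k l => F j i k l) = quad4 F.
Proof.
rewrite /quad4 exchange_big; apply: eq_bigr => i _; apply: eq_bigr => j _.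
by apply: eq_bigr => k _; apply: eq_bigr => l _; rewrite f_sym.
Qed.

Lemma quad4_swapr F : quad4 (fun i j k l => F i j l k) = quad4 F.
Proof.
apply: eq_bigr => i _; apply: eq_bigr => j _; rewrite exchange_big.
by apply: eq_bigr => k _; apply: eq_bigr => l _; rewrite (f_sym l k).
Qed.

Lemma quad4_flip F : quad4 (fun i j k l => F k l i j) = quad4 F.
Proof.
rewrite /quad4.
under eq_bigr do rewrite exchange_big.
rewrite exchange_big; apply: eq_bigr => k _ /=.
under eq_bigr do rewrite exchange_big.
rewrite exchange_big /=.
apply: eq_bigr => l _; apply: eq_bigr => i _; apply: eq_bigr => j _.
by rewrite (mulrC (f i j)).
Qed.

Lemma quad4_1 : quad4 (fun _ _ _ _ => 1) = (\sum_i G i) ^+ 2.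
Proof.
rewrite expr2 mulr_suml; apply: eq_bigr => i _; rewrite mulr_suml.
apply: eq_bigr => j _; rewrite mulr_sumr; apply: eq_bigr => k _.
by rewrite mulr_sumr; apply: eq_bigr => l _; rewrite mulr1.
Qed.

Lemma quad4_edge : quad4 (fun i j k l => A i k) = \sum_i G i * opr A G i.
Proof.
apply: eq_bigr => i _; rewrite mulr_suml; apply: eq_bigr => j _.
rewrite mulr_sumr; apply: eq_bigr => k _; rewrite !mulr_sumr.
by apply: eq_bigr => l _; ring.
Qed.

Lemma quad4_cherry : quad4 (fun i j k l => A i k * A i l) = \sum_i G i * beta i.
Proof.
apply: eq_bigr => i _; rewrite mulr_suml; apply: eq_bigr => j _.
rewrite mulr_sumr; apply: eq_bigr => k _; rewrite !mulr_sumr.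
by apply: eq_bigr => l _; rewrite (A_sym k) (A_sym l); ring.
Qed.

(** After exchanging [k] and [l] this is the trace of [(f A)^2], written entrywise so that
    [signed_matching_ge] covers it together with the path term. *)
Lemma quad4_matching : quad4 (fun i j k l => A i k * A j l) =
  \sum_i \sum_k opr A (f i) k * opr A (f k) i.
Proof.
rewrite -quad4_swapr; apply: eq_bigr => i _ /=; rewrite exchange_big.
apply: eq_bigr => k _ /=; rewrite /opr mulr_suml; apply: eq_bigr => j _.
by rewrite mulr_sumr; apply: eq_bigr => l _; rewrite (A_sym k j); ring.
Qed.

Lemma quad4_path : quad4 (fun i j k l => A i k * A i l * A j k) =
  \sum_i \sum_k A i k * (opr A (f i) k * opr A (f k) i).
Proof.
apply: eq_bigr => i _ /=; rewrite exchange_big; apply: eq_bigr => k _ /=.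
rewrite /opr mulr_suml mulr_sumr; apply: eq_bigr => j _; rewrite !mulr_sumr.
by apply: eq_bigr => l _; rewrite (A_sym k j); ring.
Qed.

(** The four factors [(1 + A) / 2] expand into 16 monomials, one for each set of edges of the
    4-cycle [i k j l]: the empty set, 4 single edges, 4 cherries, 2 matchings, 4 three-edge paths
    and the full cycle. Swapping [i, j], swapping [k, l], or exchanging the two pairs fixes
    [f i j * f k l], so monomials of one shape have equal sums. *)
Lemma quad4_adjacency :
  quad4 (fun i j k l => W i k * W i l * W j k * W j l) =
  16^-1 * ((\sum_i G i) ^+ 2 + 4 * (\sum_i G i * opr A G i)
    + 4 * (\sum_i G i * beta i)
    + 2 * (\sum_i \sum_k opr A (f i) k * opr A (f k) i)
    + 4 * (\sum_i \sum_k A i k * (opr A (f i) k * opr A (f k) i))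
    + quad4 (fun i j k l => A i k * A i l * A j k * A j l)).
Proof.
pose E (i j k l : T) := A i k : R.
pose C (i j k l : T) := A i k * A i l : R.
pose N i j k l := A i k * A j l : R.
pose P i j k l := A i k * A i l * A j k : R.
pose Z i j k l := A i k * A i l * A j k * A j l : R.
have -> : quad4 (fun i j k l => W i k * W i l * W j k * W j l) =
  quad4 (fun i j k l => 16^-1 * (1 +
   (E i j k l + (E j i k l + (E i j l k + (E j i l k +
   (C i j k l + (C j i k l + (C k l i j + (C l k i j +
   (N i j k l + (N i j l k +
   (P i j k l + (P j i k l + (P i j l k + (P j i l k + Z i j k l)))))))))))))))).
  apply: eq_quad4 => i j k l; rewrite !W_half /E /C /N /P /Z.
  by rewrite (A_sym k i) (A_sym k j) (A_sym l i) (A_sym l j); field.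
rewrite quad4Z !quad4D quad4_1.
rewrite (quad4_swapl (fun i j k l => E i j l k)) (quad4_swapl E) (quad4_swapr E).
rewrite (quad4_flip (fun i j k l => C j i k l)) (quad4_flip C) (quad4_swapl C).
rewrite (quad4_swapr N).
rewrite (quad4_swapl (fun i j k l => P i j l k)) (quad4_swapl P) (quad4_swapr P).
rewrite -quad4_edge -quad4_cherry -quad4_matching -quad4_path -/E -/C -/N -/P -/Z.
by ring.
Qed.

Lemma form11_adjacency : \sum_i \sum_j x i * x j * W i j =
  2^-1 * ((\sum_i x i) ^+ 2 + \sum_i x i * opr A x i).
Proof.
rewrite expr2 mulr_suml -big_split mulr_sumr; apply: eq_bigr => i _ /=.
rewrite !mulr_sumr -big_split mulr_sumr; apply: eq_bigr => j _ /=.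
by rewrite !W_half; field.
Qed.

Lemma form12_adjacency :
  \sum_k \sum_i \sum_j x k * f i j * (W i k * W j k) =
  4^-1 * ((\sum_i x i) * (\sum_i G i) + 2 * (\sum_i x i * opr A G i)
          + \sum_i x i * beta i).
Proof.
have -> : 2 * (\sum_k x k * opr A G k) =
    \sum_k (\sum_i \sum_j x k * f i j * A i k + \sum_i \sum_j x k * f i j * A j k).
  rewrite mulr_sumr; apply: eq_bigr => k _.
  have -> : \sum_i \sum_j x k * f i j * A j k = \sum_i \sum_j x k * f i j * A i k.
    rewrite exchange_big; apply: eq_bigr => i _; apply: eq_bigr => j _.
    by rewrite (f_sym j).
  rewrite -mulr2n -[RHS]mulr_natl; congr (_ * _); rewrite mulr_sumr.
  apply: eq_bigr => i _; rewrite !mulr_sumr.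
  by apply: eq_bigr => j _; rewrite (A_sym k i); ring.
rewrite mulr_suml -!big_split mulr_sumr; apply: eq_bigr => k _ /=.
rewrite !mulr_sumr -!big_split mulr_sumr; apply: eq_bigr => i _ /=.
rewrite !mulr_sumr -!big_split mulr_sumr; apply: eq_bigr => j _ /=.
by rewrite !W_half; field.
Qed.

Lemma form22_adjacency :
  \sum_i \sum_j \sum_l f i j * f i l * W j l =
  2^-1 * ((\sum_i G i ^+ 2) + \sum_i \sum_j f i j * opr A (f i) j).
Proof.
rewrite -big_split mulr_sumr; apply: eq_bigr => i _ /=.
rewrite expr2 mulr_suml -big_split mulr_sumr; apply: eq_bigr => j _ /=.
rewrite !mulr_sumr -big_split mulr_sumr; apply: eq_bigr => l _ /=.
by rewrite !W_half; field.
Qed.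

Variables (kappa eps : R).
Hypothesis kappa_gt0 : 0 < kappa.
Hypothesis kappa_small : 100 * 100 * kappa <= 1.
Hypothesis eps_gt0 : 0 < eps.
Hypothesis eps_small : 100 * 1000 * eps <= 1.
Hypothesis A_norm : forall y : T -> R,
  \sum_i opr A y i ^+ 2 <= (eps / kappa) ^+ 2 * \sum_i y i ^+ 2.
Hypothesis beta_norm :
  \sum_k beta k ^+ 2 <= eps ^+ 2 / kappa ^+ 3 * \sum_i \sum_j f i j ^+ 2.
Hypothesis cycle_norm :
  - (eps / kappa ^+ 2 * \sum_i \sum_j f i j ^+ 2) <=
  quad4 (fun i j k l => A i k * A i l * A j k * A j l).

Let a2 := 4 * kappa ^+ 2.
Let a3 := 128 * kappa ^+ 3.
Let a4 := 128 * 100 * kappa ^+ 4.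

Lemma dot_opr_ge (s : R) (y z : T -> R) : 0 < s ->
  - (s * (\sum_i y i ^+ 2) + s^-1 * ((eps / kappa) ^+ 2 * \sum_i z i ^+ 2))
  <= 2 * \sum_i y i * opr A z i.
Proof.
move=> s0; apply: le_trans (sum_mul_ge y (opr A z) s0).
by rewrite lerN2 lerD2l ler_wpM2l ?invr_ge0 ?(ltW s0).
Qed.

Lemma dot_beta_ge (s : R) (y : T -> R) : 0 < s ->
  - (s * (\sum_i y i ^+ 2)
     + s^-1 * (eps ^+ 2 / kappa ^+ 3 * \sum_i \sum_j f i j ^+ 2))
  <= 2 * \sum_i y i * beta i.
Proof.
move=> s0; apply: le_trans (sum_mul_ge y beta s0).
by rewrite lerN2 lerD2l ler_wpM2l ?invr_ge0 ?(ltW s0).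
Qed.

(** As [c i k] is a sign, [2 c a b >= - (a^2 + b^2)]. The two sums of squares agree after exchanging
    [i] and [k], and [A_norm] bounds them row by row. *)
Lemma signed_matching_ge (c : T -> T -> R) : (forall i k, c i k ^+ 2 = 1) ->
  - ((eps / kappa) ^+ 2 * \sum_i \sum_j f i j ^+ 2) <=
  \sum_i \sum_k c i k * (opr A (f i) k * opr A (f k) i).
Proof.
move=> c2; set u := (X in - X); set v := (X in _ <= X).
suff : - (u + u) <= v + v by lra.
have le_u : \sum_i \sum_k opr A (f i) k ^+ 2 <= u.
  by rewrite /u mulr_sumr; apply: ler_sum => i _.
apply: (@le_trans _ _ (- \sum_i \sum_k (opr A (f i) k ^+ 2 + opr A (f k) i ^+ 2))).
  rewrite lerN2; under eq_bigr do rewrite big_split.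
  by rewrite big_split /= lerD // exchange_big.
rewrite -big_split -sumrN; apply: ler_sum => i _ /=.
rewrite -big_split -sumrN; apply: ler_sum => k _ /=.
have := sqr_ge0 (c i k * opr A (f i) k + opr A (f k) i).
by rewrite sqrrD exprMn c2; set a := opr A _ _; set b := opr A _ _; lra.
Qed.

(** The rank-one terms form two squares, and the diagonal leaves positive multiples of
    [p = kappa * x2], [q = kappa^3 * G2] and [r = kappa^2 * f2]. The norm hypotheses are scaled so
    that every error is at most a constant times [eps] times these quantities; only the cross term
    [xG] has the same order as the diagonal. *)
Lemma pseudo_moment_form_ge0 (x0 : R) :
  0 <= x0 ^+ 2 + 2 * kappa * x0 * (\sum_i x i) + 2 * a2 * x0 * (\sum_i G i)
  + (a2 * (\sum_i \sum_j x i * x j * W i j) + (kappa - a2) * (\sum_i x i ^+ 2))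
  + (2 * a3 * (\sum_k \sum_i \sum_j x k * f i j * (W i k * W j k))
     + 4 * (a2 - a3) * (\sum_i x i * G i))
  + (a4 * quad4 (fun i j k l => W i k * W i l * W j k * W j l)
     + 4 * (a3 - a4) * (\sum_i \sum_j \sum_l f i j * f i l * W j l)
     + 2 * (a2 - 2 * a3 + a4) * (\sum_i \sum_j f i j ^+ 2)).
Proof.
rewrite quad4_adjacency form11_adjacency form12_adjacency form22_adjacency.
have k0 := kappa_gt0; have e0 := eps_gt0.
have e1 : eps <= 1 by have := eps_small; lra.
have [c32 c100] : 0 <= 1 - 32 * kappa <= 1 /\ 0 <= 1 - 100 * kappa <= 1.
  by have := kappa_small; split; lra.
have kN0 : kappa != 0 by rewrite gt_eqF.
have eN0 : eps != 0 by rewrite gt_eqF.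
have h0 : 0 < eps / kappa by rewrite divr_gt0.
have h20 : 0 < eps / kappa ^+ 2 by rewrite divr_gt0 ?exprn_gt0.
(* With this weight the cross term [xG] costs [p / 2 + 128 q], which is half of the leading diagonal
   [p + 256 q]. *)
have s0 : 0 < (16 * kappa)^-1 by rewrite invr_gt0 mulr_gt0.
have := dot_opr_ge x x h0; have := dot_opr_ge x G h20; have := dot_opr_ge G G h0.
have := dot_beta_ge x h20; have := dot_beta_ge G h0.
have := sum_mul_ge x G s0.
have fAf : - (2 * (eps / kappa) * \sum_i \sum_j f i j ^+ 2) <=
    2 * \sum_i \sum_j f i j * opr A (f i) j.
  rewrite !mulr_sumr -sumrN; apply: ler_sum => i _.
  apply: le_trans (dot_opr_ge _ _ h0); rewrite lerN2 le_eqVlt; apply/orP; left.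
  by apply/eqP; field; apply/andP.
have := signed_matching_ge A_sqr.
have : - ((eps / kappa) ^+ 2 * \sum_i \sum_j f i j ^+ 2) <=
    \sum_i \sum_k opr A (f i) k * opr A (f k) i.
  have := @signed_matching_ge (fun _ _ => 1) (fun _ _ => expr1n _ _).
  by under [X in _ <= X -> _]eq_bigr do under eq_bigr do rewrite mul1r.
move: cycle_norm fAf.
set R4 := quad4 _; set fAf := \sum_i \sum_j f i j * _.
set f2 := \sum_i \sum_j f i j ^+ 2.
set R2 := \sum_i \sum_k opr A (f i) k * _.
set R3 := \sum_i \sum_k A i k * _.
set xG := \sum_i x i * G i; set x2 := \sum_i x i ^+ 2; set G2 := \sum_i G i ^+ 2.
set xb := \sum_i x i * beta i; set Gb := \sum_i G i * beta i.
set xAG := \sum_i x i * opr A G i; set xAx := \sum_i x i * opr A x i.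
set GAG := \sum_i G i * opr A G i; set s1 := \sum_i x i; set s2 := \sum_i G i.
have x20 : 0 <= x2 by exact: sum_sqr_ge0.
have G20 : 0 <= G2 by exact: sum_sqr_ge0.
have f20 : 0 <= f2 by apply: sumr_ge0 => i _; apply: sum_sqr_ge0.
move=> hR4 hfAf hR2 hR3 hxG hGb hxb hGAG hxAG hxAx.
have ks := kappa_small; have es := eps_small.
clearbody R4 fAf f2 R2 R3 xG x2 G2 xb Gb xAG xAx GAG s1 s2.
pose p := kappa * x2; pose q := kappa ^+ 3 * G2; pose r := kappa ^+ 2 * f2.
have p0 : 0 <= p by rewrite mulr_ge0 ?(ltW k0).
have q0 : 0 <= q by rewrite mulr_ge0 ?exprn_ge0 ?(ltW k0).
have r0 : 0 <= r by rewrite mulr_ge0 ?exprn_ge0 ?(ltW k0).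
have kn n : 0 <= kappa ^+ n by rewrite exprn_ge0 ?(ltW k0).
have scale (c d m : nat) (l u l' : R) :
    c%:R * d%:R * kappa ^+ m * l = l' -> l <= u ->
    l' <= c%:R * d%:R * kappa ^+ m * u.
  move=> <-; apply: ler_wpM2l; apply: mulr_ge0 (kn m).
  by apply: mulr_ge0; exact: ler0n.
have {}hR4 : - (8 * 100 * eps * r) <= 8 * 100 * kappa ^+ 4 * R4.
  apply: (scale 8 100 4 _ _ _ _ hR4).
  by rewrite /r; field.
have {}hfAf : - (256 * eps * r) <= 128 * 1 * kappa ^+ 3 * (2 * fAf).
  apply: (scale 128 1 3 _ _ _ _ hfAf).
  by rewrite /r; field.
have {}hR2 : - (16 * 100 * eps ^+ 2 * r) <= 16 * 100 * kappa ^+ 4 * R2.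
  apply: (scale 16 100 4 _ _ _ _ hR2).
  by rewrite /r; field.
have {}hR3 : - (32 * 100 * eps ^+ 2 * r) <= 32 * 100 * kappa ^+ 4 * R3.
  apply: (scale 32 100 4 _ _ _ _ hR3).
  by rewrite /r; field.
have {}hGb : - (16 * 100 * eps * (q + r)) <= 16 * 100 * kappa ^+ 4 * (2 * Gb).
  apply: (scale 16 100 4 _ _ _ _ hGb).
  by rewrite /q /r; field; apply/andP.
have {}hxb : - (32 * eps * (p + r)) <= 32 * 1 * kappa ^+ 3 * (2 * xb).
  apply: (scale 32 1 3 _ _ _ _ hxb).
  by rewrite /p /r; field; apply/andP.
have {}hGAG : - (32 * 100 * eps * q) <= 16 * 100 * kappa ^+ 4 * (2 * GAG).
  apply: (scale 16 100 4 _ _ _ _ hGAG).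
  by rewrite /q; field; apply/andP.
have {}hxAG : - (64 * eps * (p + q)) <= 64 * 1 * kappa ^+ 3 * (2 * xAG).
  apply: (scale 64 1 3 _ _ _ _ hxAG).
  by rewrite /p /q; field; apply/andP.
have {}hxAx : - (2 * eps * p) <= 1 * 1 * kappa ^+ 2 * (2 * xAx).
  apply: (scale 1 1 2 _ _ _ _ hxAx).
  by rewrite /p; field; apply/andP.
have {}hxG : - (2^-1 * p + 128 * q) <= 8 * 1 * kappa ^+ 2 * (2 * xG).
  apply: (scale 8 1 2 _ _ _ _ hxG).
  by rewrite /p /q; field.
set goal := (X in 0 <= X).
(* The completion of squares is exact: the coefficients of [s1^2], [s1 * s2], [s2^2] in the form are
   [2 kappa^2], [64 kappa^3], [800 kappa^4], with [2 = 1 + 1], [64 = 8 + 56] and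
   [800 = 4^2 + 28^2]. *)
have -> : goal = (x0 + kappa * s1 + 4 * kappa ^+ 2 * s2) ^+ 2
    + (kappa * s1 + 28 * kappa ^+ 2 * s2) ^+ 2
    + (1 - 4 * kappa) * p + (1 - 32 * kappa) * (8 * 1 * kappa ^+ 2 * (2 * xG))
    + (256 - 256 * 100 * kappa) * q + (8 - 512 * kappa + 256 * 100 * kappa ^+ 2) * r
    + kappa ^+ 2 * (2 * xAx) + 64 * kappa ^+ 3 * (2 * xAG)
    + 32 * kappa ^+ 3 * (2 * xb) + (1 - 100 * kappa) * (128 * 1 * kappa ^+ 3 * (2 * fAf))
    + 16 * 100 * kappa ^+ 4 * (2 * GAG) + 16 * 100 * kappa ^+ 4 * (2 * Gb)
    + 16 * 100 * kappa ^+ 4 * R2 + 32 * 100 * kappa ^+ 4 * R3 + 8 * 100 * kappa ^+ 4 * R4.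
  by rewrite /goal /p /q /r /a2 /a3 /a4; field.
have kp : 100 * 100 * (kappa * p) <= p by rewrite mulrA ler_piMl.
have kq : 100 * 100 * (kappa * q) <= q by rewrite mulrA ler_piMl.
have kr : 100 * 100 * (kappa * r) <= r by rewrite mulrA ler_piMl.
have k2r : 0 <= kappa ^+ 2 * r by rewrite mulr_ge0.
have ep : 100 * 1000 * (eps * p) <= p by rewrite mulrA ler_piMl.
have eq : 100 * 1000 * (eps * q) <= q by rewrite mulrA ler_piMl.
have er : 100 * 1000 * (eps * r) <= r by rewrite mulrA ler_piMl.
have e2r : 100 * 1000 * (eps ^+ 2 * r) <= r.
  apply: le_trans er; rewrite expr2 -(mulrA eps) ler_wpM2l ?mulr_ge0 ?ler0n //.
  apply: ler_piMl; first by rewrite mulr_ge0 ?(ltW e0).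
  exact: e1.
(* The lower bound is at most 0, so multiplying the bounded term by a factor in [[0, 1]] preserves
   it; likewise for [fAf] below. *)
have {}hxG : - (2^-1 * p + 128 * q) <=
    (1 - 32 * kappa) * (8 * 1 * kappa ^+ 2 * (2 * xG)).
  have [xG0|xG0] := lerP 0 (8 * 1 * kappa ^+ 2 * (2 * xG)).
    apply: (@le_trans _ _ 0); first
      by rewrite oppr_le0 addr_ge0 // mulr_ge0 // ?invr_ge0 ?ler0n.
    by apply: mulr_ge0 xG0; case/andP: c32.
  by apply: (le_trans hxG); apply: ler_niMl; [exact: ltW | case/andP: c32].
have {}hfAf : - (256 * eps * r) <=
    (1 - 100 * kappa) * (128 * 1 * kappa ^+ 3 * (2 * fAf)).
  have er0 : 0 <= eps * r by rewrite mulr_ge0 ?(ltW e0).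
  have [fAf0|fAf0] := lerP 0 (128 * 1 * kappa ^+ 3 * (2 * fAf)).
    apply: (@le_trans _ _ 0); first by rewrite -mulrA oppr_le0 mulr_ge0 ?ler0n.
    by apply: mulr_ge0 fAf0; case/andP: c100.
  by apply: (le_trans hfAf); apply: ler_niMl; [exact: ltW | case/andP: c100].
have := sqr_ge0 (x0 + kappa * s1 + 4 * kappa ^+ 2 * s2).
have := sqr_ge0 (kappa * s1 + 28 * kappa ^+ 2 * s2).
move: hR4 hR2 hR3 hGb hxb hGAG hxAG hxAx.
lra.
Qed.

End QuadraticForm.

(** A duality argument: with [c] the adjoint map applied to [beta], [b = |beta|^2] is the inner
    product of [f] and [c], so [b^2 <= F |c|^2]. The Gram matrix of the adjoint has entries
    [N k l ^+ 2]; its diagonal contributes [#|T|^2 b], and its off-diagonal part at most [h b] by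
    Cauchy-Schwarz and the fourth-moment hypothesis. *)
Lemma codegree_norm (R : realFieldType) (T : finType) (A f : T -> T -> R) (h : R) :
  (forall i j, A i j ^+ 2 = 1) -> 0 <= h ->
  \sum_k \sum_(l | l != k) (\sum_i A i k * A i l) ^+ 4 <= h ^+ 2 ->
  \sum_k (\sum_i \sum_j f i j * (A i k * A j k)) ^+ 2 <=
  (#|T|%:R ^+ 2 + h) * \sum_i \sum_j f i j ^+ 2.
Proof.
move=> A_sqr h0 hN; set F := \sum_i \sum_j _.
pose beta k := \sum_i \sum_j f i j * (A i k * A j k).
pose N k l := \sum_i A i k * A i l.
have -> : \sum_k (\sum_i \sum_j f i j * (A i k * A j k)) ^+ 2 = \sum_k beta k ^+ 2 by [].
set b := \sum_k beta k ^+ 2.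
have b0 : 0 <= b by exact: sum_sqr_ge0.
have F0 : 0 <= F by apply: sumr_ge0 => i _; exact: sum_sqr_ge0.
pose c (p : T * T) := \sum_k beta k * (A p.1 k * A p.2 k).
have bE : b = \sum_p f p.1 p.2 * c p.
  rewrite -(pair_bigA _ (fun i j => f i j * c (i, j))) /=.
  rewrite /b; under [LHS]eq_bigr => k _ do rewrite expr2 {2}/beta mulr_sumr.
  rewrite exchange_big; apply: eq_bigr => i _ /=.
  under eq_bigr do rewrite mulr_sumr.
  rewrite exchange_big; apply: eq_bigr => j _ /=.
  by rewrite mulr_sumr; apply: eq_bigr => k _; ring.
clearbody beta.
have cE : \sum_p c p ^+ 2 = \sum_k \sum_l beta k * beta l * N k l ^+ 2.
  rewrite -(pair_bigA _ (fun i j => c (i, j) ^+ 2)) /=.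
  rewrite /c /=; under eq_bigr do under eq_bigr do rewrite expr2 mulr_suml.
  under eq_bigr do rewrite exchange_big.
  rewrite exchange_big; apply: eq_bigr => k _ /=.
  under eq_bigr do under eq_bigr do rewrite mulr_sumr.
  under eq_bigr do rewrite exchange_big.
  rewrite exchange_big; apply: eq_bigr => l _ /=.
  rewrite expr2 {1}/N mulr_suml mulr_sumr; apply: eq_bigr => i _ /=.
  by rewrite /N !mulr_sumr; apply: eq_bigr => j _; ring.
have diag k : N k k = #|T|%:R.
  by rewrite /N; under eq_bigr do rewrite -expr2 A_sqr; rewrite sumr_const.
have c_le : \sum_p c p ^+ 2 <= (#|T|%:R ^+ 2 + h) * b.
  rewrite cE; under eq_bigr => k do rewrite (bigD1 k) //= diag -expr2.
  rewrite big_split /= -mulr_suml -/b mulrDl mulrC lerD2l.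
  set u := \sum_k _.
  have uE : u = \sum_(p : T * T)
      (beta p.1 * beta p.2) * (if p.2 != p.1 then N p.1 p.2 ^+ 2 else 0).
    rewrite -(pair_bigA _ (fun k l =>
      (beta k * beta l) * (if l != k then N k l ^+ 2 else 0))) /=.
    apply: eq_bigr => k _; rewrite big_mkcond; apply: eq_bigr => l _ /=.
    by case: ifP => _; rewrite ?mulr0.
  have hb0 : 0 <= h * b by rewrite mulr_ge0.
  have [u0|u0] := lerP u 0; first exact: le_trans hb0.
  rewrite -(@ler_pXn2r _ 2) ?nnegrE ?(ltW u0) // uE.
  apply: (le_trans (cauchy_schwarz _ _)); rewrite exprMn mulrC.
  apply: ler_pM; [exact: sum_sqr_ge0|exact: sum_sqr_ge0| |].
    apply: le_trans hN.
    rewrite -(pair_bigA _ (fun k l => (if l != k then N k l ^+ 2 else 0) ^+ 2)) /=.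
    apply: ler_sum => k _; rewrite [leRHS]big_mkcond; apply: ler_sum => l _ /=.
    by case: ifP => _; rewrite ?expr0n -?exprM.
  rewrite -(pair_bigA _ (fun k l => (beta k * beta l) ^+ 2)) /=.
  rewrite expr2 mulr_suml; apply: ler_sum => k _; rewrite mulr_sumr.
  by apply: ler_sum => l _; rewrite exprMn.
have : b ^+ 2 <= F * ((#|T|%:R ^+ 2 + h) * b).
  rewrite {1}bE; apply: (le_trans (cauchy_schwarz _ _)).
  by rewrite -(pair_bigA _ (fun i j => f i j ^+ 2)) ler_wpM2l.
have [b_gt0|] := ltP 0 b; first by rewrite expr2 mulrA ler_pM2r // mulrC.
move=> b_le0 _; apply: (le_trans b_le0).
by rewrite mulr_ge0 // addr_ge0 // exprn_ge0.
Qed.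

(** * The pseudo-moment matrix *)

Section Adjacency.
Variables (n : nat).
Implicit Types (G : graph n) (S : {set 'I_n}).

(** Going through [is_clique] makes the relation reflexive, so products of [adj] factors stay
    correct when vertices coincide. *)
Definition adj G (i j : 'I_n) : bool := is_clique G [set i; j]%SET.

Lemma adjC G i j : adj G i j = adj G j i.
Proof. by rewrite /adj finset.setUC. Qed.

Lemma is_cliqueS G S S' : S' \subset S -> is_clique G S -> is_clique G S'.
Proof.
move=> S'S /forallP cS; apply/forallP => e; apply/implyP => eS'.
by apply: (implyP (cS e)); apply: fintype.subset_trans S'S.
Qed.

Lemma is_cliqueP G S :
  reflect {in S &, forall i j, adj G i j} (is_clique G S).
Proof.
apply: (iffP idP) => [cS i j iS jS|cS].
  by apply: is_cliqueS cS; rewrite finset.subUset !finset.sub1set iS.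
apply/forallP => e; apply/implyP => eS.
have /cards2P[a [b [ab eE]]] := valP e.
have /forallP cab : adj G a b.
  by apply: cS; apply: (fintype.subsetP eS); rewrite eE !inE eqxx ?orbT.
have : val e \subset [set a; b]%SET by rewrite eE fintype.subxx.
by move=> eab; have := implyP (cab e) eab.
Qed.

Lemma is_clique1 G i : is_clique G [set i]%SET.
Proof.
apply/forallP => e; apply/implyP => /subset_leq_card.
by rewrite (eqP (valP e)) cards1.
Qed.

Lemma adjj G i : adj G i i.
Proof. by rewrite /adj finset.setUid is_clique1. Qed.

Lemma is_clique_pairs G i j k l :
  is_clique G ([set i; j] :|: [set k; l])%SET =
  [&& adj G i j, adj G k l, adj G i k, adj G i l, adj G j k & adj G j l].
Proof.
apply/is_cliqueP/and5P.
  move=> c; split; rewrite ?c ?inE ?eqxx ?orbT //.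
move=> [ij kl ik il /andP[jk jl]] a b; rewrite !inE -!orbA.
by do 2![case/or4P => /eqP->]; rewrite ?adjj // adjC.
Qed.

End Adjacency.

Section SmallSets.
Variables (R : realType) (n : nat).

Fact small2_subproof (i j : 'I_n) : (#|[set i; j]%SET| <= 2)%N.
Proof. by rewrite cards2; case: eqP. Qed.

Definition small2 (i j : 'I_n) : small n := Sub [set i; j]%SET (small2_subproof i j).

Lemma small2C i j : small2 i j = small2 j i.
Proof. by apply: val_inj; rewrite /= finset.setUC. Qed.

Lemma sum_small1 (S : small n) : #|val S| = 1%N ->
  \sum_i (S == small1 i)%:R = 1 :> R.
Proof.
move=> /eqP/cards1P[a Sa]; rewrite (bigD1 a) //= big1 ?addr0 => [|i ia].
  by rewrite -val_eqE /= Sa eqxx.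
rewrite -val_eqE /= Sa; case: eqP => // /setP/(_ i).
by rewrite !inE eqxx (negbTE ia).
Qed.

Lemma sum_small2 (S : small n) : #|val S| = 2%N ->
  \sum_i \sum_j ((i != j) && (S == small2 i j))%:R = 2 :> R.
Proof.
move=> /eqP/cards2P[a [b [ab Sab]]].
have row i c : c != i -> val S = [set i; c]%SET ->
    \sum_j ((i != j) && (S == small2 i j))%:R = 1 :> R.
  move=> ci Sic; rewrite (bigD1 c) //= big1 ?addr0 => [|j jc].
    by rewrite eq_sym ci -val_eqE /= Sic eqxx.
  case: (eqVneq i j) => //= ij; rewrite -val_eqE /= Sic.
  case: eqP => // /setP/(_ j).
  by rewrite !inE eqxx orbT (negbTE jc) orbF eq_sym (negbTE ij).
rewrite (bigD1 a) //= (row a b) // 1?eq_sym //.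
rewrite (bigD1 b) 1?eq_sym //= (row b a) //; last by rewrite Sab finset.setUC.
rewrite big1 ?addr0 // => i /andP[ia ib]; rewrite big1 // => j _.
case: eqP => [//|_] /=; rewrite -val_eqE /= Sab.
by case: eqP => // /setP/(_ i); rewrite !inE eqxx (negbTE ia) (negbTE ib).
Qed.

(** Each small set receives total weight 1 from the three sums: a two-element set comes from two
    ordered pairs, each of weight one half. *)
Lemma sum_small (h : small n -> R) :
  \sum_S h S = h (small0 n) + \sum_i h (small1 i)
    + 2^-1 * \sum_i \sum_j (i != j)%:R * h (small2 i j).
Proof.
have weight (S : small n) : (S == small0 n)%:R + \sum_i (S == small1 i)%:R
    + 2^-1 * \sum_i \sum_j ((i != j) && (S == small2 i j))%:R = 1 :> R.
  have : (#|val S| <= 2)%N by exact: valP S.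
  case E: #|val S| => [|[|[|//]]] _.
  - have S0 : S = small0 n by apply: val_inj; apply/eqP; rewrite -cards_eq0 E.
    rewrite S0 eqxx !big1 ?mulr0 ?addr0 // => i _.
      rewrite big1 // => j _; case: eqP => //= ij.
      by rewrite -val_eqE eq_sym -cards_eq0 /= cards2.
    by rewrite -val_eqE eq_sym -cards_eq0 /= cards1.
  - rewrite sum_small1 // -val_eqE -cards_eq0 E add0r big1 ?mulr0 ?addr0 // => i _.
    rewrite big1 // => j _; case: eqP => //= /eqP ij; case: eqP => // Sij.
    by move: E; rewrite Sij /= cards2 ij.
  - rewrite sum_small2 // -val_eqE -cards_eq0 E add0r big1 ?add0r => [|i _].
      by rewrite mulVf ?pnatr_eq0.
    by case: eqP => // Si; move: E; rewrite Si /= cards1.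
have pick (T : small n) : \sum_S (S == T)%:R * h S = h T.
  rewrite (bigD1 T) //= eqxx mul1r big1 ?addr0 // => S /negbTE ->.
  by rewrite mul0r.
under eq_bigr => S do rewrite -[h S]mul1r -(weight S) !mulrDl -mulrA.
rewrite !big_split /= pick -mulr_sumr; congr (_ + _ + _ * _).
  under [LHS]eq_bigr do rewrite mulr_suml.
  by rewrite exchange_big; apply: eq_bigr => i _; rewrite pick.
under [LHS]eq_bigr do rewrite mulr_suml.
rewrite exchange_big; apply: eq_bigr => i _ /=.
under [LHS]eq_bigr do rewrite mulr_suml.
rewrite exchange_big; apply: eq_bigr => j _ /=.
by rewrite -[in RHS]pick mulr_sumr; apply: eq_bigr => S _; rewrite mulrA -natrM mulnb.
Qed.

End SmallSets.

(** * Pseudo-moments and the expansion of their quadratic form *)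

Section PseudoMoments.
Variables (R : realType) (n : nat) (kappa : R).

(* The factors 4, 128, 12800 make the moment sequence so strictly log-convex
   that the rank-one parts of the quadratic form stay positive. *)
Definition clique_moment (s : nat) : R :=
  nth 0 [:: 1; kappa; 4 * kappa ^+ 2; 128 * kappa ^+ 3; 128 * 100 * kappa ^+ 4] s.

Definition set_moment (G : graph n) (S : {set 'I_n}) : R :=
  if is_clique G S then clique_moment #|S| else 0.

Definition moment_mx (G : graph n) : 'M[R]_#|{: small n}| :=
  \matrix_(a, b) set_moment G (val (enum_val a) :|: val (enum_val b))%SET.

Definition sgn_adj (G : graph n) (i j : 'I_n) : R := if adj G i j then 1 else -1.

Lemma entry_moment G S T : entry (moment_mx G) S T =
  set_moment G (val S :|: val T)%SET.
Proof. by rewrite /entry mxE !enum_rankK. Qed.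

Lemma sgn_adjC G i j : sgn_adj G i j = sgn_adj G j i.
Proof. by rewrite /sgn_adj adjC. Qed.

Lemma sgn_adj_sqr G i j : sgn_adj G i j ^+ 2 = 1.
Proof. by rewrite /sgn_adj; case: ifP; rewrite ?sqrrN expr1n. Qed.

Lemma adj_sgn G i j : (adj G i j)%:R = (1 + sgn_adj G i j) / 2.
Proof. by rewrite /sgn_adj; case: adj => /=; field. Qed.

Lemma card_pair_union (i j k l : 'I_n) : i != j -> k != l ->
  #|([set i; j] :|: [set k; l])%SET| =
  (4 - ((i == k) + (i == l) + (j == k) + (j == l)))%N.
Proof.
move=> ij kl; rewrite -finset.setUA !cardsU1 cards1 !inE (negbTE ij) (negbTE kl) /=.
have excl (a b c : 'I_n) : b != c -> ~~ ((a == b) && (a == c)).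
  by apply: contra => /andP[/eqP<- /eqP<-].
have := excl i k l kl; have := excl j k l kl.
have := excl k i j ij; have := excl l i j ij; rewrite ![_ == i]eq_sym ![_ == j]eq_sym.
by case: (i == k); case: (i == l); case: (j == k); case: (j == l).
Qed.

Section Form.
Variables (G : graph n) (u : small n -> R).

Let W (i j : 'I_n) : R := (adj G i j)%:R.
Let m := set_moment G.
Let a2 := 4 * kappa ^+ 2.
Let a3 := 128 * kappa ^+ 3.
Let a4 := 128 * 100 * kappa ^+ 4.

Definition vertex_coef (i : 'I_n) : R := u (small1 i).

(** The factor one half compensates for summing over ordered pairs. Coefficients at non-edges are
    set to 0, as the corresponding rows of the moment matrix vanish; the indicators of the edges
    [i j] and [k l] can then be dropped. *)
Definition edge_coef (i j : 'I_n) : R :=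
  2^-1 * ((i != j) && adj G i j)%:R * u (small2 i j).

Let x := vertex_coef.
Let f := edge_coef.

Lemma edge_coef_sym i j : f i j = f j i.
Proof. by rewrite /f /edge_coef eq_sym adjC small2C. Qed.

Lemma edge_coef_diag i : f i i = 0.
Proof. by rewrite /f /edge_coef eqxx mulr0 mul0r. Qed.

Lemma edge_coef_non_adj i j : ~~ adj G i j -> f i j = 0.
Proof. by move=> /negbTE ij; rewrite /f /edge_coef ij andbF mulr0 mul0r. Qed.

Lemma edge_coef_adj i j : f i j * W i j = f i j.
Proof.
have [ij|ij] := boolP (adj G i j); first by rewrite /W ij mulr1.
by rewrite edge_coef_non_adj // mul0r.
Qed.

Lemma set_moment_non_clique S : ~~ is_clique G S -> m S = 0.
Proof. by rewrite /m /set_moment => /negbTE ->. Qed.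

Lemma sum_coef (h : small n -> R) :
  (forall i j, ~~ adj G i j -> h (small2 i j) = 0) ->
  \sum_S u S * h S = u (small0 n) * h (small0 n) + \sum_i x i * h (small1 i)
    + \sum_i \sum_j f i j * h (small2 i j).
Proof.
move=> h0; rewrite sum_small mulr_sumr; congr (_ + _); apply: eq_bigr => i _.
rewrite mulr_sumr; apply: eq_bigr => j _; rewrite /f /edge_coef.
have [ij|/h0 ->] := boolP (adj G i j); last by rewrite !mulr0.
by rewrite andbT; ring.
Qed.

Lemma vertex_vertex_moment i j :
  m ([set i] :|: [set j])%SET = W i j * (a2 + (kappa - a2) * (i == j)%:R).
Proof.
rewrite /m /set_moment /W /adj; case: ifP => _; last by rewrite mul0r.
by rewrite cards2; case: eqP => _; rewrite /clique_moment /= -?/a2; ring.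
Qed.

Lemma vertex_edge_moment k i j :
  f i j * m ([set k] :|: [set i; j])%SET = f i j *
    (W i k * W j k * (a3 + (a2 - a3) * ((i == k)%:R + (j == k)%:R))).
Proof.
have [<-|ij] := eqVneq i j; first by rewrite edge_coef_diag !mul0r.
have [aij|] := boolP (adj G i j); last first.
  by move/edge_coef_non_adj => ->; rewrite !mul0r.
congr (_ * _); rewrite /m /set_moment -{1}(finset.setUid [set k]%SET).
rewrite is_clique_pairs adjj aij /W (adjC _ i k) (adjC _ j k).
case: (adj G k i); case: (adj G k j); rewrite ?mul0r ?mulr0 ?mul0r //= !mul1r.
rewrite cardsU1 cards2 ij !inE ![_ == k]eq_sym.
have [ki|_] := eqVneq k i; have [kj|_] := eqVneq k j; rewrite /clique_moment /=.
- by rewrite -ki -kj eqxx in ij.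
- by rewrite -/a2; ring.
- by rewrite -/a2; ring.
- by rewrite -/a3; ring.
Qed.

(** The bracket interpolates the moment by the number of coincidences between the two pairs: none
    gives [a4], one gives [a3], and two give [a4 + 2 (a3 - a4) + (a2 - 2 a3 + a4) = a2]. *)
Lemma edge_edge_moment i j k l :
  f i j * f k l * m ([set i; j] :|: [set k; l])%SET = f i j * f k l *
    (W i k * W i l * W j k * W j l *
     (a4 + (a3 - a4) * ((i == k)%:R + (i == l)%:R + (j == k)%:R + (j == l)%:R)
      + (a2 - 2 * a3 + a4) *
        ((i == k)%:R * (j == l)%:R + (i == l)%:R * (j == k)%:R))).
Proof.
have [<-|ij] := eqVneq i j; first by rewrite edge_coef_diag !mul0r.
have [<-|kl] := eqVneq k l; first by rewrite edge_coef_diag !(mulr0, mul0r).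
have [aij|] := boolP (adj G i j); last first.
  by move/edge_coef_non_adj => ->; rewrite !mul0r.
have [akl|] := boolP (adj G k l); last first.
  by move/edge_coef_non_adj => ->; rewrite !(mulr0, mul0r).
congr (_ * _); rewrite /m /set_moment is_clique_pairs aij akl /W.
case: (adj G i k); case: (adj G i l); case: (adj G j k); case: (adj G j l);
  rewrite ?mul0r ?mulr0 ?mul0r //= !mul1r.
rewrite card_pair_union //.
have excl (a b c : 'I_n) : b != c -> ~~ ((a == b) && (a == c)).
  by apply: contra => /andP[/eqP<- /eqP<-].
have := excl i k l kl; have := excl j k l kl.
have := excl k i j ij; have := excl l i j ij; rewrite ![_ == i]eq_sym ![_ == j]eq_sym.
case: (i == k); case: (i == l); case: (j == k); case: (j == l) => //= _ _ _ _;
  by rewrite /clique_moment /= -?/a2 -?/a3 -?/a4; ring.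
Qed.

(** Both sums over small sets split into empty, vertex and edge parts, and the Kronecker deltas of
    the moment formulas collapse sums. The factor 4 before [a3 - a4] counts the ways one vertex can
    be shared by two edges, and the factor 2 before [a2 - 2 a3 + a4] the ways the edges can
    coincide. *)
Lemma moment_form :
  \sum_S u S * (\sum_S' u S' * m (val S :|: val S')%SET) =
  u (small0 n) ^+ 2 + 2 * kappa * u (small0 n) * (\sum_i x i)
  + 2 * a2 * u (small0 n) * (\sum_i \sum_j f i j)
  + (a2 * (\sum_i \sum_j x i * x j * W i j) + (kappa - a2) * (\sum_i x i ^+ 2))
  + (2 * a3 * (\sum_k \sum_i \sum_j x k * f i j * (W i k * W j k))
     + 4 * (a2 - a3) * (\sum_i x i * (\sum_j f i j)))
  + (a4 * quad4 f (fun i j k l => W i k * W i l * W j k * W j l)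
     + 4 * (a3 - a4) * (\sum_i \sum_j \sum_l f i j * f i l * W j l)
     + 2 * (a2 - 2 * a3 + a4) * (\sum_i \sum_j f i j ^+ 2)).
Proof.
set x0 := u (small0 n).
have delta (F : 'I_n -> R) i : \sum_j (i == j)%:R * F j = F i.
  rewrite (bigD1 i) //= eqxx mul1r big1 ?addr0 // => j.
  by rewrite eq_sym => /negbTE ->; rewrite mul0r.
have deltar (F : 'I_n -> R) i : \sum_j F j * (j == i)%:R = F i.
  by rewrite -[RHS]delta; apply: eq_bigr => j _; rewrite eq_sym mulrC.
have deltal (F : 'I_n -> R) i : \sum_j F j * (i == j)%:R = F i.
  by rewrite -[RHS]delta; apply: eq_bigr => j _; rewrite mulrC.
have W1 i : W i i = 1 by rewrite /W adjj.
have WC i j : W i j = W j i by rewrite /W adjC.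
have row S : \sum_S' u S' * m (val S :|: val S')%SET =
    x0 * m (val S) + \sum_i x i * m (val S :|: [set i])%SET
    + \sum_i \sum_j f i j * m (val S :|: [set i; j])%SET.
  rewrite sum_coef ?finset.setU0 // => i j; move=> ij; apply: set_moment_non_clique.
  by apply: contra ij; apply: is_cliqueS; rewrite finset.subsetUr.
under eq_bigr do rewrite row; rewrite sum_coef => [|i j ij]; last first.
  have m0 S : m ([set i; j] :|: S)%SET = 0.
    apply: set_moment_non_clique.
    by apply: contra ij; apply: is_cliqueS; rewrite finset.subsetUl.
  rewrite /= -[X in m X]finset.setU0 m0 mulr0 add0r.
  rewrite !big1 ?addr0 // => k _; last by rewrite m0 mulr0.
  by rewrite big1 // => l _; rewrite m0 mulr0.
have m0 : m finset.set0 = 1.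
  rewrite /m /set_moment cards0 (_ : is_clique _ _) //.
  by apply/is_cliqueP => i j; rewrite !inE.
have m1 i : m [set i]%SET = kappa by rewrite /m /set_moment is_clique1 cards1.
have fm2 i j : f i j * m [set i; j]%SET = a2 * f i j.
  have [<-|ij] := eqVneq i j; first by rewrite edge_coef_diag mul0r mulr0.
  have [aij|/edge_coef_non_adj ->] := boolP (adj G i j); last by rewrite mul0r mulr0.
  by rewrite mulrC /m /set_moment ifT // cards2 ij.
have s02 : \sum_i \sum_j f i j * m [set i; j]%SET = a2 * \sum_i \sum_j f i j.
  rewrite mulr_sumr; apply: eq_bigr => i _; rewrite mulr_sumr.
  by apply: eq_bigr => j _.
have s11 : \sum_i x i * (\sum_k x k * m ([set i] :|: [set k])%SET) =
    a2 * (\sum_i \sum_j x i * x j * W i j) + (kappa - a2) * (\sum_i x i ^+ 2).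
  rewrite !mulr_sumr -big_split; apply: eq_bigr => i _ /=.
  have -> : x i ^+ 2 = \sum_k (i == k)%:R * (x i * x k * W i k).
    by rewrite delta W1; ring.
  rewrite !mulr_sumr -big_split; apply: eq_bigr => k _ /=.
  by rewrite vertex_vertex_moment; ring.
have s12 : \sum_k x k * (\sum_i \sum_j f i j * m ([set k] :|: [set i; j])%SET) =
    a3 * (\sum_k \sum_i \sum_j x k * f i j * (W i k * W j k))
    + 2 * (a2 - a3) * (\sum_i x i * (\sum_j f i j)).
  rewrite !mulr_sumr -big_split; apply: eq_bigr => k _ /=.
  pose F i j := x k * f i j * (W i k * W j k).
  have Ei : \sum_i \sum_j F i j * (i == k)%:R = x k * (\sum_j f k j).
    rewrite exchange_big /= mulr_sumr; apply: eq_bigr => j _.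
    by rewrite deltar /F W1 mul1r (WC j) -mulrA edge_coef_adj.
  have Ej : \sum_i \sum_j F i j * (j == k)%:R = x k * (\sum_j f k j).
    rewrite mulr_sumr; apply: eq_bigr => j _.
    by rewrite deltar /F W1 mulr1 -mulrA edge_coef_adj edge_coef_sym.
  have -> : 2 * (a2 - a3) * (x k * (\sum_j f k j)) =
      (a2 - a3) * (\sum_i \sum_j F i j * (i == k)%:R)
      + (a2 - a3) * (\sum_i \sum_j F i j * (j == k)%:R).
    by rewrite Ei Ej; ring.
  rewrite !mulr_sumr -!big_split; apply: eq_bigr => i _ /=.
  rewrite !mulr_sumr -!big_split; apply: eq_bigr => j _ /=.
  by rewrite vertex_edge_moment /F; ring.
pose Q i j k l := W i k * W i l * W j k * W j l.
have s22 : \sum_i \sum_j f i j *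
    (\sum_k \sum_l f k l * m ([set i; j] :|: [set k; l])%SET) =
    a4 * quad4 f Q
    + 4 * (a3 - a4) * (\sum_i \sum_j \sum_l f i j * f i l * W j l)
    + 2 * (a2 - 2 * a3 + a4) * (\sum_i \sum_j f i j ^+ 2).
  (* [P] is the kernel of one coincidence and [D] that of two; the other placements follow from the
     symmetries of [quad4]. *)
  pose P i j k l := Q i j k l * (i == k)%:R.
  pose D i j k l := Q i j k l * (i == k)%:R * (j == l)%:R.
  have -> : \sum_i \sum_j \sum_l f i j * f i l * W j l = quad4 f P.
    apply: eq_bigr => i _; apply: eq_bigr => j _.
    rewrite exchange_big; apply: eq_bigr => l _ /=.
    under eq_bigr do rewrite /P mulrA.
    rewrite deltal /Q W1 mul1r -[in LHS](edge_coef_adj i j).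
    by rewrite -[in LHS](edge_coef_adj i l) (WC j i); ring.
  have -> : \sum_i \sum_j f i j ^+ 2 = quad4 f D.
    apply: eq_bigr => i _; apply: eq_bigr => j _.
    under eq_bigr do under eq_bigr do rewrite /D mulrA.
    under eq_bigr do rewrite deltal mulrA.
    by rewrite deltal /Q !W1 -[in LHS](edge_coef_adj i j) (WC j i); ring.
  have -> : \sum_i \sum_j f i j *
      (\sum_k \sum_l f k l * m ([set i; j] :|: [set k; l])%SET) =
      quad4 f (fun i j k l => a4 * Q i j k l
        + (a3 - a4) * (P i j k l + (P i j l k + (P j i k l + P j i l k)))
        + (a2 - 2 * a3 + a4) * (D i j k l + D i j l k)).
    apply: eq_bigr => i _; apply: eq_bigr => j _; rewrite mulr_sumr.
    apply: eq_bigr => k _; rewrite mulr_sumr; apply: eq_bigr => l _.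
    by rewrite mulrA edge_edge_moment /P /D /Q; ring.
  have fs := edge_coef_sym.
  rewrite !quad4D !quad4Z !quad4D (quad4_swapl fs (fun i j k l => P i j l k)).
  rewrite (quad4_swapl fs P) (quad4_swapr fs P) (quad4_swapr fs D).
  by ring.
have s21 : \sum_i \sum_j f i j * (\sum_k x k * m ([set i; j] :|: [set k])%SET) =
    \sum_k x k * (\sum_i \sum_j f i j * m ([set k] :|: [set i; j])%SET).
  under [RHS]eq_bigr do rewrite mulr_sumr.
  rewrite [RHS]exchange_big; apply: eq_bigr => i _ /=.
  under [RHS]eq_bigr do rewrite mulr_sumr.
  rewrite [RHS]exchange_big; apply: eq_bigr => j _ /=.
  rewrite mulr_sumr; apply: eq_bigr => k _.
  by rewrite finset.setUC; ring.
have s01 : \sum_i x i * m [set i]%SET = kappa * \sum_i x i.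
  by rewrite mulr_sumr; apply: eq_bigr => i _; rewrite m1 mulrC.
rewrite /= -/x0; under [X in x0 * (_ + X + _)]eq_bigr do rewrite finset.set0U.
under [X in x0 * (_ + X)]eq_bigr do under eq_bigr do rewrite finset.set0U.
under [X in _ + X + _]eq_bigr do rewrite !mulrDr (mulrCA _ x0).
under [X in _ + X]eq_bigr do under eq_bigr do rewrite !mulrDr (mulrCA _ x0).
under [X in _ + X]eq_bigr do rewrite !big_split /= -mulr_sumr.
rewrite !big_split /= -!mulr_sumr s02 s01 s11 s12 s21 s12 s22 m0 /Q.
by ring.
Qed.

End Form.

End PseudoMoments.

(** * Feasibility of the pseudo-moment matrix for pseudo-random graphs *)

Section Feasible.
Variables (R : realType) (n : nat).
Implicit Types (G : graph n).

(** Degenerate pairs get 0. This costs nothing, as [f] vanishes on the diagonal, and it lets the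
    parity argument for walks assume that each pair has distinct entries. *)
Definition cycle_mx (A : 'I_n -> 'I_n -> R) (p q : 'I_n * 'I_n) : R :=
  if (p.1 != p.2) && (q.1 != q.2)
  then A p.1 q.1 * A p.1 q.2 * A p.2 q.1 * A p.2 q.2 else 0.

Lemma cycle_mxC A p q : (forall i j, A i j = A j i) ->
  cycle_mx A p q = cycle_mx A q p.
Proof.
move=> AC; rewrite /cycle_mx andbC; case: ifP => // _.
by rewrite (AC p.1) (AC p.1) (AC p.2) (AC p.2); ring.
Qed.

Lemma quad4_cycle_ge (A f : 'I_n -> 'I_n -> R) (h : R) :
  (forall i j, A i j = A j i) -> (forall i, f i i = 0) -> 0 < h ->
  cube_frob (cycle_mx A) <= h ^+ 6 ->
  - (h * \sum_i \sum_j f i j ^+ 2) <=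
  quad4 f (fun i j k l => A i k * A i l * A j k * A j l).
Proof.
move=> AC f0 h0 hM; pose fp (p : 'I_n * 'I_n) := f p.1 p.2.
have fpE : \sum_i \sum_j f i j ^+ 2 = \sum_p fp p ^+ 2.
  by rewrite -(pair_bigA _ (fun i j => f i j ^+ 2)).
have -> : quad4 f (fun i j k l => A i k * A i l * A j k * A j l) =
    \sum_p fp p * opr (cycle_mx A) fp p.
  rewrite -(pair_bigA _ (fun i j => fp (i, j) * opr (cycle_mx A) fp (i, j))) /=.
  apply: eq_bigr => i _; apply: eq_bigr => j _.
  rewrite /opr -(pair_bigA _ (fun k l => cycle_mx A (i, j) (k, l) * fp (k, l))) /=.
  rewrite mulr_sumr; apply: eq_bigr => k _; rewrite mulr_sumr; apply: eq_bigr => l _.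
  rewrite /fp /cycle_mx /=.
  have [<-|_] := eqVneq i j; first by rewrite f0 !mul0r.
  have [<-|_] := eqVneq k l; first by rewrite f0 !(mulr0, mul0r).
  by rewrite /=; ring.
have cC p q : cycle_mx A p q = cycle_mx A q p by exact: cycle_mxC.
have := sum_mul_ge fp (opr (cycle_mx A) fp) h0.
have := opr_norm cC fp (ltW h0) hM.
rewrite fpE; set F := \sum_p fp p ^+ 2; set K := \sum_p opr _ _ _ ^+ 2.
move=> KF; have {KF} : h^-1 * K <= h * F.
  by rewrite ler_pdivrMl // mulrA -expr2.
set S := \sum_p _; lra.
Qed.

Lemma clique_moment_bounds (kappa : R) s : 0 < kappa -> 100 * 100 * kappa <= 1 ->
  0 <= clique_moment kappa s <= 1.
Proof.
move=> k0 k1; have k0' := ltW k0.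
have k2 : 0 <= kappa ^+ 2 <= kappa.
  by rewrite exprn_ge0 // expr2 ler_piMr //; lra.
have k3 : 0 <= kappa ^+ 3 <= kappa.
  by rewrite exprn_ge0 //= exprS ler_piMr //; lra.
have k4 : 0 <= kappa ^+ 4 <= kappa * kappa.
  by rewrite exprn_ge0 //= exprS ler_wpM2l //; lra.
have k12 : 100 * 100 * (kappa * kappa) <= kappa by rewrite mulrA ler_piMl.
rewrite /clique_moment; case: s => [|[|[|[|[|s]]]]] /=; try lra.
by rewrite nth_nil lexx ler01.
Qed.

Variables kappa eps : R.
Hypothesis kappa_gt0 : 0 < kappa.
Hypothesis kappa_small : 100 * 100 * kappa <= 1.

Hypothesis eps_gt0 : 0 < eps.
Hypothesis eps_small : 100 * 1000 * eps <= 1.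

(** The first two conditions bound the norms of the signed adjacency and 4-cycle matrices by
    [eps / kappa] and [eps / kappa^2]. The third bounds the off-diagonal codegrees by half of what
    the norm of [diag (A f A)] may reach. *)
Definition pseudo_random G : bool :=
  [&& cube_frob (sgn_adj R G) <= (eps / kappa) ^+ 6,
      cube_frob (cycle_mx (sgn_adj R G)) <= (eps / kappa ^+ 2) ^+ 6
    & \sum_k \sum_(l | l != k) (\sum_i sgn_adj R G i k * sgn_adj R G i l) ^+ 4
      <= (eps ^+ 2 / (2 * kappa ^+ 3)) ^+ 2].

Lemma moment_mx_psd G : n%:R ^+ 2 <= eps ^+ 2 / (2 * kappa ^+ 3) ->
  pseudo_random G -> psdmx (moment_mx kappa G).
Proof.
move=> hn /and3P[hA hM hN].
have e0 := eps_gt0.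
split; first by apply/matrixP => a b; rewrite !mxE finset.setUC.
move=> v; pose u (S : small n) := v (enum_rank S) 0.
have -> : (v^T *m moment_mx kappa G *m v) 0 0 =
    \sum_S u S * (\sum_S' u S' * set_moment kappa G (val S :|: val S')%SET).
  rewrite mxE (reindex enum_rank) /=; last by apply: onW_bij; exact: enum_rank_bij.
  apply: eq_bigr => S _; rewrite mulrC; congr (_ * _).
  rewrite mxE (reindex enum_rank) /=; last by apply: onW_bij; exact: enum_rank_bij.
  by apply: eq_bigr => S' _; rewrite !mxE !enum_rankK finset.setUC.
rewrite moment_form; pose f := edge_coef G u.
have AC := sgn_adjC R G; have A2 := sgn_adj_sqr R G.
have h0 : 0 < eps / kappa by rewrite divr_gt0.
have beta_le : \sum_k (\sum_i \sum_j f i j *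
      (sgn_adj R G i k * sgn_adj R G j k)) ^+ 2
    <= eps ^+ 2 / kappa ^+ 3 * \sum_i \sum_j f i j ^+ 2.
  have d0 : 0 <= eps ^+ 2 / (2 * kappa ^+ 3).
    by rewrite divr_ge0 ?mulr_ge0 ?exprn_ge0 ?ler0n ?(ltW e0) ?(ltW kappa_gt0).
  apply: (le_trans (codegree_norm f A2 d0 hN)).
  apply: ler_wpM2r; first by apply: sumr_ge0 => i _; exact: sum_sqr_ge0.
  (* One half of the bound pays for the diagonal [n^2], the other for the off-diagonal codegrees. *)
  rewrite card_ord; have -> : eps ^+ 2 / kappa ^+ 3 =
      eps ^+ 2 / (2 * kappa ^+ 3) + eps ^+ 2 / (2 * kappa ^+ 3).
    by field; rewrite gt_eqF.
  by rewrite lerD2r.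
have cyc_ge : - (eps / kappa ^+ 2 * \sum_i \sum_j f i j ^+ 2) <=
    quad4 f (fun i j k l => sgn_adj R G i k * sgn_adj R G i l *
      sgn_adj R G j k * sgn_adj R G j l).
  apply: quad4_cycle_ge => //; first exact: edge_coef_diag.
  by rewrite divr_gt0 ?exprn_gt0.
exact: (pseudo_moment_form_ge0 AC A2 (vertex_coef u) (edge_coef_sym G u)
  (adj_sgn R G) kappa_gt0 kappa_small e0 eps_small
  (fun y => opr_norm AC y (ltW h0) hA) beta_le cyc_ge (u (small0 n))).
Qed.

Lemma moment_mx_feasible G : n%:R ^+ 2 <= eps ^+ 2 / (2 * kappa ^+ 3) ->
  pseudo_random G -> sos4_feasible G (moment_mx kappa G).
Proof.
move=> hn hG; split.
- exact: moment_mx_psd.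
- move=> S T; rewrite entry_moment /set_moment; case: ifP => _.
    exact: clique_moment_bounds.
  by rewrite lexx ler01.
- by move=> S T; rewrite entry_moment /set_moment => /negbTE ->.
- by move=> S1 S2 S3 S4 E; rewrite !entry_moment E.
- rewrite entry_moment /= finset.setU0 /set_moment cards0 ifT //.
  by apply/is_cliqueP => i j; rewrite !inE.
Qed.

Lemma moment_mx_objective G : sos4_objective (moment_mx kappa G) = n%:R * kappa.
Proof.
rewrite /sos4_objective; under eq_bigr => i _ do
  rewrite entry_moment /= finset.setUid /set_moment is_clique1 cards1.
by rewrite sumr_const card_ord mulr_natl.
Qed.

End Feasible.

(** * Monotonicity and lower bounds for the SOS value *)

Section Value.
Variables (R : realType) (n : nat).
Implicit Types (G : graph n).

Lemma is_clique_mono G G' S : G \subset G' -> is_clique G S -> is_clique G' S.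
Proof.
move=> GG' /forallP cS; apply/forallP => e; apply/implyP => eS.
exact: (fintype.subsetP GG') (implyP (cS e) eS).
Qed.

(** The graph enters only through the vanishing constraints, and adding edges removes some of
    these. *)
Lemma sos4_feasible_mono G G' (X : 'M[R]_#|{: small n}|) :
  G \subset G' -> sos4_feasible G X -> sos4_feasible G' X.
Proof.
move=> GG' [? ? X0 ? ?]; split => // S T ST; apply: X0.
by apply: contra ST; exact: is_clique_mono.
Qed.

(** A supremum dominates its set only when the set is bounded above; here [n] is a bound because
    diagonal entries are at most 1. *)
Lemma Val4_ge G (X : 'M[R]_#|{: small n}|) :
  sos4_feasible G X -> sos4_objective X <= Val4 R G.
Proof.
move=> hX; apply: ub_le_sup; last by exists X.
exists n%:R => _ [Y [_ Y01 _ _ _] <-].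
rewrite /sos4_objective -[n in leRHS]card_ord -sumr_const; apply: ler_sum => i _.
by have /andP[] := Y01 (small1 i) (small1 i).
Qed.

End Value.

(** * Moments of the random graph *)

Section FewDistinctEntries.
Variables (T I : finType).

Lemma count_sum (P : pred T) (s : seq T) :
  count P s = (\sum_(x : T) P x * count_mem x s)%N.
Proof.
elim: s => [|y s IHs] /=; first by rewrite big1 // => x _; rewrite muln0.
under eq_bigr do rewrite mulnDr; rewrite big_split /= -IHs; congr (_ + _)%N.
rewrite (bigD1 y) //= eqxx muln1 big1 ?addn0 // => x.
by rewrite eq_sym => /negbTE ->; rewrite muln0.
Qed.

(** A value present in [s] either occurs at least twice or is counted once more by the second
    term. *)
Lemma size_undup_le (s : seq T) :
  (2 * size (undup s) <= size s + count (fun x => count_mem x s == 1) s)%N.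
Proof.
have -> : size (undup s) = (\sum_(x : T) (x \in s))%N.
  rewrite -(card_uniqP (undup_uniq s)) -sum1_card big_mkcond /=.
  by apply: eq_bigr => x _; rewrite mem_undup; case: (x \in s).
rewrite -(count_predT s) !count_sum -big_split big_distrr /=.
apply: leq_sum => x _; rewrite -has_pred1 has_count.
by case: (count_mem x s) => [|[|c]].
Qed.

(** A sequence is determined by the list of its distinct entries, padded to length [r.+1], and the
    position in that list of each of its [m.+1] terms. *)
Lemma card_few_distinct (g : I -> seq T) (m r : nat) :
  injective g -> (forall i, size (g i) = m.+1) ->
  (#|[pred i | (size (undup (g i)) <= r.+1)%N]| <= r.+1 ^ m.+1 * #|T| ^ r.+1)%N.
Proof.
move=> g_inj g_size; set P := [pred i | _].
case: (pickP P) => [i0 _|P0]; last by rewrite eq_card0.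
have [x0 _] : exists x, x \in g i0.
  by case: (g i0) (g_size i0) => // x s _; exists x; rewrite mem_head.
pose code i : {ffun 'I_m.+1 -> 'I_r.+1} * {ffun 'I_r.+1 -> T} :=
  ([ffun k : 'I_m.+1 => inord (index (nth x0 (g i) k) (undup (g i)))],
   [ffun j : 'I_r.+1 => nth x0 (undup (g i)) j]).
have decode i (k : 'I_m.+1) : i \in P -> nth x0 (g i) k = (code i).2 ((code i).1 k).
  move=> Pi; rewrite !ffunE.
  have xs : nth x0 (g i) k \in undup (g i).
    by rewrite mem_undup mem_nth // g_size.
  by rewrite inordK ?nth_index // (leq_trans _ Pi) // index_mem.
rewrite -[X in (_ <= X)%N]
  (_ : #|{: {ffun 'I_m.+1 -> 'I_r.+1} * {ffun 'I_r.+1 -> T}}| = _).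
  apply: (@leq_card_in _ _ code) => i j Pi Pj Eij; apply: g_inj.
  apply: (@eq_from_nth _ x0); first by rewrite !g_size.
  move=> k; rewrite g_size => km.
  by rewrite (decode i (Ordinal km)) // (decode j (Ordinal km)) // Eij.
by rewrite card_prod !card_ffun !card_ord.
Qed.

End FewDistinctEntries.

(** * Expectation over the uniform random graph *)

Section Mean.
Variables (R : realType) (n : nat).
Implicit Types (G : graph n) (F : graph n -> R).

Definition mean F : R := \sum_G erdos_renyi 2^-1 G * F G.

Lemma erdos_renyi_half G : erdos_renyi (2^-1 : R) G = 2^-1 ^+ #|{: edge n}|.
Proof.
rewrite /erdos_renyi (eq_bigr (fun _ => 2^-1)) ?prodr_const // => e _.
by case: ifP => // _; field.
Qed.

Lemma erdos_renyi_half_ge0 G : 0 <= erdos_renyi (2^-1 : R) G.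
Proof. by rewrite erdos_renyi_half exprn_ge0 // invr_ge0 ler0n. Qed.

Lemma mean1 : mean (fun _ => 1) = 1.
Proof.
rewrite /mean; under eq_bigr do rewrite mulr1 erdos_renyi_half.
have cardG : #|{: graph n}| = (2 ^ #|{: edge n}|)%N.
  by rewrite -cardsT -powersetT card_powerset cardsT.
by rewrite sumr_const cardG -[LHS]mulr_natr natrX -exprMn mulVf ?expr1n.
Qed.

Lemma mean_sum (I : finType) (P : pred I) (F : I -> graph n -> R) :
  mean (fun G => \sum_(i | P i) F i G) = \sum_(i | P i) mean (F i).
Proof.
by rewrite /mean exchange_big; apply: eq_bigr => G _; rewrite mulr_sumr.
Qed.

Lemma le_mean F F' : (forall G, F G <= F' G) -> mean F <= mean F'.
Proof.
by move=> FF'; apply: ler_sum => G _; rewrite ler_wpM2l // erdos_renyi_half_ge0.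
Qed.

Lemma mean_le1 F : (forall G, F G <= 1) -> mean F <= 1.
Proof. by move=> F1; rewrite -mean1; exact: le_mean. Qed.

Lemma markov F (c : R) : 0 < c -> (forall G, 0 <= F G) ->
  prob (@erdos_renyi R n 2^-1) (fun G => ~~ (F G <= c)) <= mean F / c.
Proof.
move=> c0 F0; rewrite ler_pdivlMr // /prob /mean mulr_suml.
rewrite [leRHS](bigID (fun G => F G <= c)) /=.
rewrite -[leLHS]add0r lerD //.
  by apply: sumr_ge0 => G _; rewrite mulr_ge0 // erdos_renyi_half_ge0.
apply: ler_sum => G; rewrite -ltNge => /ltW cF.
by rewrite ler_wpM2l // erdos_renyi_half_ge0.
Qed.

Definition flip (e : edge n) G : graph n := [set x | (x \in G) (+) (x == e)]%SET.

Lemma flipK e : involutive (flip e).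
Proof. by move=> G; apply/setP => x; rewrite !inE addbK. Qed.

(** All graphs have equal weight at edge probability one half, so toggling an edge is a
    measure-preserving involution. *)
Lemma mean_odd e F : (forall G, F (flip e G) = - F G) -> mean F = 0.
Proof.
move=> Fodd; have : mean F = - mean F.
  rewrite {1}/mean (reindex_inj (inv_inj (flipK e))) /mean -sumrN.
  by apply: eq_bigr => G _; rewrite Fodd !erdos_renyi_half mulrN.
by move=> E; lra.
Qed.

Fact pair_edge_subproof (i j : 'I_n) : i != j -> #|[set i; j]%SET| == 2%N.
Proof. by rewrite cards2 => ->. Qed.

Definition pair_edge (i j : 'I_n) (ij : i != j) : edge n :=
  Sub [set i; j]%SET (pair_edge_subproof ij).

Lemma adjE G i j (ij : i != j) : adj G i j = (pair_edge ij \in G).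
Proof.
apply/forallP/idP => [/(_ (pair_edge ij))|ijG e].
  by rewrite fintype.subxx.
apply/implyP => eij; suff -> : e = pair_edge ij by [].
by apply/val_inj/eqP; rewrite eqEcard eij (eqP (valP e)) cards2 ij.
Qed.

Lemma sgn_adj_flip G v y (vy : v != y) i j :
  sgn_adj R (flip (pair_edge vy) G) i j =
  (-1) ^+ (((i == v) && (j == y)) || ((i == y) && (j == v))) * sgn_adj R G i j.
Proof.
rewrite /sgn_adj; have [<-|ij] := eqVneq i j.
  rewrite !adjj mulr1 (_ : _ || _ = false) //.
  by case: eqP => [->|_]; rewrite ?(negbTE vy) ?andbF.
rewrite !(adjE _ ij) inE.
have -> : (pair_edge ij == pair_edge vy) =
    ((i == v) && (j == y)) || ((i == y) && (j == v)).
  have excl (a b c : 'I_n) : b != c -> ~~ ((a == b) && (a == c)).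
    by apply: contra => /andP[/eqP<- /eqP<-].
  have := excl v i j ij; have := excl y i j ij.
  have := excl i v y vy; have := excl j v y vy.
  rewrite -[_ == pair_edge vy]val_eqE /= finset.eqEsubset !finset.subUset.
  rewrite !finset.sub1set !inE.
  rewrite ![v == _]eq_sym ![y == _]eq_sym.
  by case: (i == v); case: (i == y); case: (j == v); case: (j == y).
by case: (_ \in G); case: (_ || _); rewrite /= ?expr0 ?expr1 ?mul1r ?mulN1r ?opprK.
Qed.

End Mean.

(** * Closed walks of length six *)

Section ClosedWalks.
Variables (R : realType) (n : nat) (T : finType) (d : nat).
Variable supp : T -> d.+1.-tuple 'I_n.
Variable K : graph n -> T -> T -> R.

Definition closed_walk (G : graph n) p0 p1 p2 p3 p4 p5 : R :=
  K G p0 p1 * K G p1 p2 * K G p2 p3 * K G p3 p4 * K G p4 p5 * K G p5 p0.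

Definition walk_supp (p : T * (T * (T * (T * (T * T))))) : seq 'I_n :=
  let: (p0, (p1, (p2, (p3, (p4, p5))))) := p in
  supp p0 ++ (supp p1 ++ (supp p2 ++ (supp p3 ++ (supp p4 ++ supp p5)))).

(* A vertex occurring only once meets only edges towards p1 and p5, and these
   must cancel in pairs. *)
Hypothesis walk_local : forall p0 p1 p2 p3 p4 p5 v,
  mean (fun G => closed_walk G p0 p1 p2 p3 p4 p5) != 0 ->
  v \in supp p0 -> count_mem v (walk_supp (p0, (p1, (p2, (p3, (p4, p5)))))) = 1%N ->
  supp p1 =i supp p5.

(** Call a position lone if it holds a vertex occurring once in the whole walk. Its two neighbours
    have equal supports, hence are not lone. If three alternate positions are lone, the other three
    share one support and four supports cover the walk. Otherwise at most two positions are lone, so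
    at most [2 * d.+1] entries occur once, and twice the number of distinct vertices is at most
    [6 * d.+1 + 2 * d.+1]. *)
Lemma closed_walk_few p0 p1 p2 p3 p4 p5 :
  mean (fun G => closed_walk G p0 p1 p2 p3 p4 p5) != 0 ->
  (size (undup (walk_supp (p0, (p1, (p2, (p3, (p4, p5))))))) <= 4 * d.+1)%N.
Proof.
move=> nz0; set s := walk_supp _.
pose lone p := has (fun v => count_mem v s == 1%N) (supp p).
have rot q0 q1 q2 q3 q4 q5 :
    mean (fun G => closed_walk G q0 q1 q2 q3 q4 q5) != 0 ->
    mean (fun G => closed_walk G q1 q2 q3 q4 q5 q0) != 0.
  by congr (_ != _); apply: eq_bigr => G _; rewrite /closed_walk; ring.
have nz1 := rot _ _ _ _ _ _ nz0; have nz2 := rot _ _ _ _ _ _ nz1.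
have nz3 := rot _ _ _ _ _ _ nz2; have nz4 := rot _ _ _ _ _ _ nz3.
have nz5 := rot _ _ _ _ _ _ nz4.
have local q0 q1 q2 q3 q4 q5 :
    (forall v, count_mem v (walk_supp (q0, (q1, (q2, (q3, (q4, q5)))))) = count_mem v s) ->
    mean (fun G => closed_walk G q0 q1 q2 q3 q4 q5) != 0 -> lone q0 ->
    supp q1 =i supp q5.
  move=> cs nz /hasP[v v0 /eqP vs]; apply: (walk_local nz v0).
  by rewrite cs.
have l0 := local _ _ _ _ _ _ (fun=> erefl) nz0.
have l1 : lone p1 -> supp p2 =i supp p0.
  by apply: local nz1 => v; rewrite /s /= !count_cat; clear; lia.
have l2 : lone p2 -> supp p3 =i supp p1.
  by apply: local nz2 => v; rewrite /s /= !count_cat; clear; lia.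
have l3 : lone p3 -> supp p4 =i supp p2.
  by apply: local nz3 => v; rewrite /s /= !count_cat; clear; lia.
have l4 : lone p4 -> supp p5 =i supp p3.
  by apply: local nz4 => v; rewrite /s /= !count_cat; clear; lia.
have l5 : lone p5 -> supp p0 =i supp p4.
  by apply: local nz5 => v; rewrite /s /= !count_cat; clear; lia.
have mem_count (v : 'I_n) (r : seq 'I_n) : v \in r -> (0 < count_mem v r)%N.
  by rewrite -has_pred1 has_count.
have twice (a b : T) : supp a =i supp b ->
    (forall v, count_mem v (supp a) + count_mem v (supp b) <= count_mem v s)%N ->
    ~~ lone a && ~~ lone b.
  move=> ab le_s; rewrite -!all_predC; apply/andP; split; apply/allP => v va /=.
    have vb : v \in supp b by rewrite -ab.
    move: (leq_trans (leq_add (mem_count _ _ va) (mem_count _ _ vb)) (le_s v)).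
    by case: (count_mem v s) => [|[|c]].
  have vb : v \in supp a by rewrite ab.
  move: (leq_trans (leq_add (mem_count _ _ vb) (mem_count _ _ va)) (le_s v)).
  by case: (count_mem v s) => [|[|c]].
have x0 : lone p0 -> ~~ lone p1 && ~~ lone p5.
  by move/l0 => E; apply: (twice _ _ E) => v; rewrite /s /= !count_cat; clear; lia.
have x1 : lone p1 -> ~~ lone p2 && ~~ lone p0.
  by move/l1 => E; apply: (twice _ _ E) => v; rewrite /s /= !count_cat; clear; lia.
have x2 : lone p2 -> ~~ lone p3 && ~~ lone p1.
  by move/l2 => E; apply: (twice _ _ E) => v; rewrite /s /= !count_cat; clear; lia.
have x3 : lone p3 -> ~~ lone p4 && ~~ lone p2.
  by move/l3 => E; apply: (twice _ _ E) => v; rewrite /s /= !count_cat; clear; lia.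
have x4 : lone p4 -> ~~ lone p5 && ~~ lone p3.
  by move/l4 => E; apply: (twice _ _ E) => v; rewrite /s /= !count_cat; clear; lia.
have alternate (a b c e : T) :
    {subset s <= supp a ++ (supp b ++ (supp c ++ supp e))} ->
    (size (undup s) <= 4 * d.+1)%N.
  move=> sub; apply: (@leq_trans (size (supp a ++ (supp b ++ (supp c ++ supp e))))).
    apply: uniq_leq_size (undup_uniq s) _ => v; rewrite mem_undup; exact: sub.
  by rewrite !size_cat !size_tuple; clear; lia.
have lone_count p : (count (fun v => count_mem v s == 1%N) (supp p) <= d.+1 * lone p)%N.
  rewrite /lone has_count; case: posnP => [->//|_] /=.
  by rewrite muln1 -[X in (_ <= X)%N](size_tuple (supp p)) count_size.
have [/and3P[s0 s2 s4]|/negbTE n024] := boolP [&& lone p0, lone p2 & lone p4].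
  apply: (alternate p0 p2 p4 p1) => v.
  by rewrite /s /= !mem_cat -(l0 s0) (l2 s2); do !case: (v \in _).
have [/and3P[s1 s3 s5]|/negbTE n135] := boolP [&& lone p1, lone p3 & lone p5].
  apply: (alternate p1 p3 p5 p0) => v.
  by rewrite /s /= !mem_cat -(l5 s5) (l1 s1); do !case: (v \in _).
have few : (lone p0 + lone p1 + lone p2 + lone p3 + lone p4 + lone p5 <= 2)%N.
  move: x0 x1 x2 x3 x4 n024 n135.
  by case: (lone p0); case: (lone p1); case: (lone p2); case: (lone p3);
    case: (lone p4); case: (lone p5) => //= h0 h1 h2 h3 h4;
    rewrite ?(h0 isT) ?(h1 isT) // => _; auto.
have lone_s : (count (fun v => count_mem v s == 1%N) s <= d.+1 * 2)%N.
  apply: leq_trans (leq_mul (leqnn d.+1) few).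
  have distr (m a b c e f g : nat) :
      (m * (a + b + c + e + f + g) = m * a + m * b + m * c + m * e + m * f + m * g)%N.
    by rewrite !mulnDr.
  rewrite {2}/s /walk_supp !count_cat !addnA distr.
  exact: (leq_add (leq_add (leq_add (leq_add (leq_add (lone_count p0)
    (lone_count p1)) (lone_count p2)) (lone_count p3)) (lone_count p4)) (lone_count p5)).
have size_s : size s = (6 * d.+1)%N by rewrite !size_cat !size_tuple; clear; lia.
have := size_undup_le s; rewrite size_s; move: lone_s.
by move: (count _ _) (size _); clear; lia.
Qed.

End ClosedWalks.

Section ClosedWalkMoment.
Variables (R : realType) (n : nat) (T : finType) (d : nat).
Variable supp : T -> d.+1.-tuple 'I_n.
Variable K : graph n -> T -> T -> R.
Hypothesis supp_inj : injective supp.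
Hypothesis K_sym : forall G p q, K G p q = K G q p.
Hypothesis K_le1 : forall G p q, `|K G p q| <= 1.
Hypothesis walk_local : forall p0 p1 p2 p3 p4 p5 v,
  mean (fun G => closed_walk K G p0 p1 p2 p3 p4 p5) != 0 ->
  v \in supp p0 -> count_mem v (walk_supp supp (p0, (p1, (p2, (p3, (p4, p5)))))) = 1%N ->
  supp p1 =i supp p5.

Lemma walk_supp_inj : injective (walk_supp supp).
Proof.
move=> [p0 [p1 [p2 [p3 [p4 p5]]]]] [q0 [q1 [q2 [q3 [q4 q5]]]]] /eqP.
rewrite /= !eqseq_cat ?size_tuple //.
by case/and5P => /eqP/val_inj/supp_inj-> /eqP/val_inj/supp_inj-> /eqP/val_inj/supp_inj->
  /eqP/val_inj/supp_inj-> /andP[/eqP/val_inj/supp_inj-> /eqP/val_inj/supp_inj->].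
Qed.

(** The bound [4 * d.+1] is written as the successor [(4 * d + 3).+1] to fit [card_few_distinct]. *)
Lemma mean_closed_walk_le p0 p1 p2 p3 p4 p5 :
  mean (fun G => closed_walk K G p0 p1 p2 p3 p4 p5) <=
  (size (undup (walk_supp supp (p0, (p1, (p2, (p3, (p4, p5)))))))
     <= (4 * d + 3).+1)%N%:R.
Proof.
have [->|nz] := eqVneq (mean (fun G => closed_walk K G p0 p1 p2 p3 p4 p5)) 0.
  by rewrite ler0n.
have -> : ((4 * d + 3).+1 = 4 * d.+1)%N by clear; lia.
rewrite (closed_walk_few walk_local nz).
apply: mean_le1 => G; apply: (le_trans (ler_norm _)); rewrite !normrM.
by do 5![apply: mulr_ile1; rewrite ?mulr_ge0 //].
Qed.

Lemma mean_cube_frob_le :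
  mean (fun G => cube_frob (K G)) <=
  ((4 * d + 3).+1 ^ (6 * d + 5).+1 * n ^ (4 * d + 3).+1)%:R.
Proof.
(* Expanding [cube_frob] lists the endpoints [i, j] first, then the inner vertices of two paths from
   [i] to [j]; the closed walk visits [i, k, l, j, l', k']. *)
pose perm (p : T * (T * (T * (T * (T * T))))) :=
  let: (i, (j, (k, (l, (k', l'))))) := p in (i, (k, (l, (j, (l', k'))))).
have perm_inj : injective perm.
  by move=> [? [? [? [? [? ?]]]]] [? [? [? [? [? ?]]]]] [-> -> -> -> -> ->].
pose g p := walk_supp supp (perm p).
have g_inj : injective g := inj_comp walk_supp_inj perm_inj.
have g_size p : size (g p) = (6 * d + 5).+1.
  move: p => [? [? [? [? [? ?]]]]]; rewrite !size_cat !size_tuple; clear; lia.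
have sum_pair (J J' : finType) (F : J * J' -> R) :
    \sum_p F p = \sum_i \sum_j F (i, j).
  by rewrite pair_bigA; apply: eq_bigr => -[].
pose walk G (q : T * (T * (T * (T * (T * T))))) :=
  let: (p0, (p1, (p2, (p3, (p4, p5))))) := q in closed_walk K G p0 p1 p2 p3 p4 p5.
have frobE G : cube_frob (K G) = \sum_p walk G (perm p).
  rewrite sum_pair; apply: eq_bigr => i _; rewrite sum_pair; apply: eq_bigr => j _.
  rewrite expr2 mulr_suml sum_pair; apply: eq_bigr => k _.
  rewrite mulr_suml sum_pair; apply: eq_bigr => l _.
  rewrite mulr_sumr sum_pair; apply: eq_bigr => k' _.
  rewrite mulr_sumr; apply: eq_bigr => l' _.
  rewrite /= /closed_walk (K_sym _ i k') (K_sym _ k' l') (K_sym _ l' j); ring.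
have -> : mean (fun G => cube_frob (K G)) = \sum_p mean (fun G => walk G (perm p)).
  by rewrite -mean_sum; apply: eq_bigr => G _; rewrite frobE.
apply: le_trans
  (_ : (#|[pred p | (size (undup (g p)) <= (4 * d + 3).+1)%N]|)%:R <= _).
  rewrite -sum1_card natr_sum [leRHS]big_mkcond; apply: ler_sum => p _ /=.
  have -> : (if p \in [pred p | (size (undup (g p)) <= (4 * d + 3).+1)%N]
    then 1 else 0) = (size (undup (g p)) <= (4 * d + 3).+1)%N%:R :> R.
    by rewrite inE; case: ifP.
  by move: p => [? [? [? [? [? ?]]]]]; exact: mean_closed_walk_le.
rewrite ler_nat -[X in (_ * X ^ _)%N]card_ord.
exact: card_few_distinct.
Qed.

End ClosedWalkMoment.

(** * Parity of walks in the signed adjacency and 4-cycle matrices *)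

Section GraphMoments.
Variables (R : realType) (n : nat).
Implicit Types (G : graph n).

Lemma norm_sgn_adj G i j : `|sgn_adj R G i j| = 1.
Proof. by rewrite /sgn_adj; case: ifP; rewrite ?normrN normr1. Qed.

Lemma sgn_flip_off G v y (vy : v != y) i j : i != v -> j != v ->
  sgn_adj R (flip (pair_edge vy) G) i j = sgn_adj R G i j.
Proof.
by move=> /negbTE iv /negbTE jv; rewrite sgn_adj_flip iv jv andbF mul1r.
Qed.

Lemma sgn_flip_on G v y (vy : v != y) j : j != v ->
  sgn_adj R (flip (pair_edge vy) G) v j = (-1) ^+ (j == y) * sgn_adj R G v j.
Proof. by move=> /negbTE jv; rewrite sgn_adj_flip eqxx jv andbF orbF. Qed.

(** As [p0] is visited once and [p1 != p5], toggling the edge [p0 p1] changes the sign of exactly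
    one factor. *)
Lemma sgn_walk_odd p0 p1 p2 p3 p4 p5 :
  p0 \notin [:: p1; p2; p3; p4; p5] -> p1 != p5 ->
  mean (fun G => closed_walk (sgn_adj R (n := n)) G p0 p1 p2 p3 p4 p5) = 0.
Proof.
rewrite !inE !negb_or !(eq_sym p0) => /and5P[n1 n2 n3 n4 n5] p15.
have n1' : p0 != p1 by rewrite eq_sym.
apply: (@mean_odd _ _ (pair_edge n1')) => G; rewrite /closed_walk.
rewrite (sgn_adjC _ _ p5 p0) !sgn_flip_on // !sgn_flip_off //.
by rewrite eqxx eq_sym (negbTE p15) expr1 expr0 (sgn_adjC _ _ p5 p0); ring.
Qed.

Lemma cycle_flip_off G v y (vy : v != y) p q :
  p.1 != v -> p.2 != v -> q.1 != v -> q.2 != v ->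
  cycle_mx (sgn_adj R (flip (pair_edge vy) G)) p q = cycle_mx (sgn_adj R G) p q.
Proof. by move=> *; rewrite /cycle_mx !sgn_flip_off. Qed.

Lemma cycle_flip_on G v y (vy : v != y) w q :
  w != v -> q.1 != v -> q.2 != v ->
  cycle_mx (sgn_adj R (flip (pair_edge vy) G)) (v, w) q =
  (-1) ^+ ((q.1 == y) + (q.2 == y)) * cycle_mx (sgn_adj R G) (v, w) q.
Proof.
move=> wv q1 q2; rewrite /cycle_mx /=; case: ifP => _; last by rewrite mulr0.
by rewrite !sgn_flip_on // !sgn_flip_off // exprD; ring.
Qed.

Definition adj_cycle_mx G := cycle_mx (sgn_adj R G).

Lemma adj_cycle_mx_sym G p q : adj_cycle_mx G p q = adj_cycle_mx G q p.
Proof. by apply: cycle_mxC => i j; exact: sgn_adjC. Qed.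

(** Toggling the edge [v y] affects only the two factors next to the unique occurrence of [v], and
    their joint sign is the parity of the number of occurrences of [y] in [p1] and [p5]. *)
Lemma cycle_walk_odd v w p1 p2 p3 p4 p5 y :
  v \notin [:: w; p1.1; p1.2; p2.1; p2.2; p3.1; p3.2; p4.1; p4.2; p5.1; p5.2] ->
  v != y -> odd ((p1.1 == y) + (p1.2 == y) + ((p5.1 == y) + (p5.2 == y))) ->
  mean (fun G => closed_walk adj_cycle_mx G (v, w) p1 p2 p3 p4 p5) = 0.
Proof.
rewrite !inE !negb_or !(eq_sym v).
move=> /and5P[nw n11 n12 n21 /and5P[n22 n31 n32 n41 /and3P[n42 n51 n52]]] yv y_odd.
have vy : v != y by rewrite eq_sym.
apply: (@mean_odd _ _ (pair_edge vy)) => G; rewrite /closed_walk.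
rewrite (adj_cycle_mx_sym _ p5 (v, w)) /adj_cycle_mx !cycle_flip_on // !cycle_flip_off //.
rewrite -/(adj_cycle_mx _) (adj_cycle_mx_sym _ p5 (v, w)).
have : (-1) ^+ ((p1.1 == y) + (p1.2 == y)) *
    (-1) ^+ ((p5.1 == y) + (p5.2 == y)) = -1 :> R.
  by rewrite -exprD -signr_odd y_odd expr1.
set s1 := _ ^+ _; set s5 := _ ^+ _; move=> s15; rewrite /adj_cycle_mx.
set a := cycle_mx _ _ _; set b := cycle_mx _ p1 _; set c := cycle_mx _ p2 _.
set e := cycle_mx _ p3 _; set f := cycle_mx _ p4 _; set g := cycle_mx _ _ _.
by transitivity (s1 * s5 * (a * b * c * e * f * g)); [ring | rewrite s15; ring].
Qed.

End GraphMoments.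

Section GraphMomentBounds.
Variables (R : realType) (n : nat).
Implicit Types (G : graph n).

Lemma mean_frob_sgn_adj :
  mean (fun G => cube_frob (sgn_adj R G)) <= (4 ^ 6 * n ^ 4)%:R.
Proof.
apply: (@mean_cube_frob_le R n 'I_n 0 (fun i => [tuple i]) (@sgn_adj R n)).
- by move=> i j /(congr1 val) [].
- exact: sgn_adjC.
- by move=> G i j; rewrite norm_sgn_adj.
move=> p0 p1 p2 p3 p4 p5 v nz; rewrite !inE => /eqP vp0.
rewrite -vp0 /= eqxx => -[] lone.
have p0N : v \notin [:: p1; p2; p3; p4; p5] by apply/count_memPn.
have [-> //|p15] := eqVneq p1 p5.
by rewrite -vp0 in nz; rewrite (sgn_walk_odd R p0N p15) eqxx in nz.
Qed.

Local Notation cyc := (@adj_cycle_mx R n).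

Lemma cyc_diag G a q : cyc G (a, a) q = 0.
Proof. by rewrite /adj_cycle_mx /cycle_mx eqxx. Qed.

Lemma cyc_swap G a b q : cyc G (a, b) q = cyc G (b, a) q.
Proof. by rewrite /adj_cycle_mx /cycle_mx /= eq_sym; case: ifP => // _; ring. Qed.

Lemma cyc_norm G p q : `|cyc G p q| <= 1.
Proof.
rewrite /adj_cycle_mx /cycle_mx; case: ifP => _; last by rewrite normr0 ler01.
by rewrite !normrM !norm_sgn_adj !mulr1.
Qed.

(** A nonzero mean forces the entries of [p1], and those of [p5], to be distinct. Each vertex then
    occurs at most once in each pair, and even parity means that it lies in both or in neither. *)
Lemma cyc_walk_local v w p1 p2 p3 p4 p5 :
  mean (fun G => closed_walk cyc G (v, w) p1 p2 p3 p4 p5) != 0 ->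
  v \notin [:: w; p1.1; p1.2; p2.1; p2.2; p3.1; p3.2; p4.1; p4.2; p5.1; p5.2] ->
  [:: p1.1; p1.2] =i [:: p5.1; p5.2].
Proof.
move=> nz vN y.
have mean0 : mean (fun _ : graph n => 0 : R) = 0.
  by rewrite /mean big1 // => G _; rewrite mulr0.
have p1_ne : p1.1 != p1.2.
  apply: contra nz => /eqP E; rewrite -[X in _ == X]mean0; apply/eqP.
  apply: eq_bigr => G _; congr (_ * _).
  by rewrite /closed_walk [p1]surjective_pairing E (cyc_diag G) !(mulr0, mul0r).
have p5_ne : p5.1 != p5.2.
  apply: contra nz => /eqP E; rewrite -[X in _ == X]mean0; apply/eqP.
  apply: eq_bigr => G _; congr (_ * _).
  by rewrite /closed_walk [p5]surjective_pairing E (cyc_diag G) !(mulr0, mul0r).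
have [<-|vy] := eqVneq v y.
  move: vN; rewrite !inE !negb_or => /and5P[_ /negbTE-> /negbTE-> _].
  by case/and5P => _ _ _ _ /and3P[_ /negbTE-> /negbTE->].
apply/eqP; move: nz; apply: contraNT => neq; apply/eqP.
apply: (@cycle_walk_odd R n v w p1 p2 p3 p4 p5 y vN vy); move: neq; rewrite !inE ![y == _]eq_sym.
have : ~~ ((p1.1 == y) && (p1.2 == y)).
  by apply: contra p1_ne => /andP[/eqP-> /eqP->].
have : ~~ ((p5.1 == y) && (p5.2 == y)).
  by apply: contra p5_ne => /andP[/eqP-> /eqP->].
by case: (p1.1 == y); case: (p1.2 == y); case: (p5.1 == y); case: (p5.2 == y).
Qed.

Lemma mean_frob_cycle_mx :
  mean (fun G => cube_frob (cyc G)) <= (8 ^ 12 * n ^ 8)%:R.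
Proof.
apply: (@mean_cube_frob_le R n _ 1 (fun p : 'I_n * 'I_n => [tuple p.1; p.2]) cyc).
- by move=> [a b] [c e] /(congr1 val) [-> ->].
- exact: adj_cycle_mx_sym.
- exact: cyc_norm.
move=> [a b] p1 p2 p3 p4 p5 v nz; rewrite !inE => /orP[] /eqP -> lone.
  apply: cyc_walk_local nz _; apply/count_memPn.
  by move: lone; rewrite /= eqxx => -[].
(* When the lone vertex is the second entry, the symmetry of the matrix under swapping a pair moves
   it to the front. *)
have nz' : mean (fun G => closed_walk cyc G (b, a) p1 p2 p3 p4 p5) != 0.
  move: nz; congr (_ != _); apply: eq_bigr => G _; rewrite /closed_walk.
  rewrite (cyc_swap _ a b) (adj_cycle_mx_sym R G p5).
  by rewrite (cyc_swap _ a b) (adj_cycle_mx_sym R G p5).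
apply: cyc_walk_local nz' _; apply/count_memPn.
by move: lone; rewrite /= eqxx addnCA => -[].
Qed.

Lemma codegree_odd (k l i j1 j2 j3 : 'I_n) :
  k != l -> i \notin [:: k; l; j1; j2; j3] ->
  mean (fun G => sgn_adj R G i k * sgn_adj R G i l
    * (sgn_adj R G j1 k * sgn_adj R G j1 l)
    * (sgn_adj R G j2 k * sgn_adj R G j2 l)
    * (sgn_adj R G j3 k * sgn_adj R G j3 l)) = 0.
Proof.
move=> kl; rewrite !inE !negb_or !(eq_sym i) => /and5P[ki li i1 i2 i3].
have ik : i != k by rewrite eq_sym.
apply: (@mean_odd _ _ (pair_edge ik)) => G.
rewrite !sgn_flip_on // !sgn_flip_off // eqxx eq_sym (negbTE kl) expr0 expr1.
by ring.
Qed.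

(** Expand the fourth power over [i1, ..., i4]. If some of these occurs once among the six vertices,
    the term has mean 0 by [codegree_odd]. Otherwise only [k] and [l] can occur once, so there are
    at most [(6 + 2) / 2 = 4] distinct vertices. *)
Lemma mean_codegree :
  mean (fun G => \sum_k \sum_(l | l != k)
    (\sum_i sgn_adj R G i k * sgn_adj R G i l) ^+ 4) <= (4 ^ 6 * n ^ 4)%:R.
Proof.
pose I6 : finType := ('I_n * ('I_n * ('I_n * ('I_n * ('I_n * 'I_n)))))%type.
pose N G (k l i : 'I_n) := sgn_adj R G i k * sgn_adj R G i l.
pose F G (p : I6) : R := let: (k, (l, (i1, (i2, (i3, i4))))) := p in
  if l != k then N G k l i1 * N G k l i2 * N G k l i3 * N G k l i4 else 0.
pose g (p : I6) : seq 'I_n := let: (k, (l, (i1, (i2, (i3, i4))))) := p in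
  [:: k; l; i1; i2; i3; i4].
have sum_pair (J J' : finType) (H : J * J' -> R) :
    \sum_p H p = \sum_i \sum_j H (i, j).
  by rewrite pair_bigA; apply: eq_bigr => -[].
have FE G : \sum_k \sum_(l | l != k) (\sum_i N G k l i) ^+ 4 = \sum_p F G p.
  rewrite sum_pair; apply: eq_bigr => k _; rewrite big_mkcond sum_pair.
  apply: eq_bigr => l _; rewrite /F; case: ifP => _; last first.
    rewrite sum_pair big1 // => i1 _; rewrite sum_pair big1 // => i2 _.
    by rewrite sum_pair big1 // => i3 _; rewrite big1.
  rewrite !exprS expr0 mulr1 mulr_suml sum_pair; apply: eq_bigr => i1 _.
  rewrite mulr_suml mulr_sumr sum_pair; apply: eq_bigr => i2 _.
  rewrite mulr_suml !mulr_sumr sum_pair; apply: eq_bigr => i3 _.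
  rewrite !mulr_sumr; apply: eq_bigr => i4 _; ring.
have -> : mean (fun G => \sum_k \sum_(l | l != k)
    (\sum_i sgn_adj R G i k * sgn_adj R G i l) ^+ 4) =
    \sum_p mean (fun G => F G p).
  by rewrite -mean_sum; apply: eq_bigr => G _; rewrite -FE.
apply: le_trans (_ : (#|[pred p | (size (undup (g p)) <= 4)%N]|)%:R <= _).
  rewrite -sum1_card natr_sum [leRHS]big_mkcond; apply: ler_sum => p _ /=.
  have -> : (if p \in [pred p | (size (undup (g p)) <= 4)%N] then 1 else 0) =
      (size (undup (g p)) <= 4)%N%:R :> R.
    by rewrite inE; case: ifP.
  have [->|] := eqVneq (mean (fun G => F G p)) 0; first by rewrite ler0n.
  move: p => [k [l [i1 [i2 [i3 i4]]]]].
  rewrite /F; have [->|lk] := eqVneq l k.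
    by rewrite /mean big1 ?eqxx // => G _; rewrite mulr0.
  move=> nz; rewrite (_ : (_ <= 4)%N = true); last first.
    set s := g _; have kl : k != l by rewrite eq_sym.
    have not_lone i j1 j2 j3 :
        (forall G, N G k l i * N G k l j1 * N G k l j2 * N G k l j3 =
          N G k l i1 * N G k l i2 * N G k l i3 * N G k l i4) ->
        perm_eq [:: i; j1; j2; j3] [:: i1; i2; i3; i4] ->
        (count_mem i s == 1%N) = false.
      move=> E /permP/(_ (pred1 i)) /= cE; apply/negP => /eqP c1.
      have iN : i \notin [:: k; l; j1; j2; j3].
        apply/count_memPn; move: c1 cE; rewrite /s /= eqxx; clear; lia.
      move/negP: nz; apply; apply/eqP; rewrite -[RHS](codegree_odd kl iN).
      by apply: eq_bigr => G _; rewrite -E.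
    have n1 := not_lone i1 i2 i3 i4 (fun _ => erefl) (perm_refl _).
    have n2 : (count_mem i2 s == 1%N) = false.
      apply: (not_lone i2 i1 i3 i4) => [G|]; first by ring.
      by apply/permP => P /=; clear; lia.
    have n3 : (count_mem i3 s == 1%N) = false.
      apply: (not_lone i3 i1 i2 i4) => [G|]; first by ring.
      by apply/permP => P /=; clear; lia.
    have n4 : (count_mem i4 s == 1%N) = false.
      apply: (not_lone i4 i1 i2 i3) => [G|]; first by ring.
      by apply/permP => P /=; clear; lia.
    have := size_undup_le s; rewrite {3}/s [count _ (g _)]/= n1 n2 n3 n4.
    rewrite [size s](_ : _ = 6%N) // addn0; move: (size (undup s)).
    by case: (count_mem k s == 1%N); case: (count_mem l s == 1%N) => u; clear; lia.
  apply: mean_le1 => G; apply: (le_trans (ler_norm _)).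
  by rewrite /N !normrM !norm_sgn_adj !mulr1.
rewrite ler_nat -[X in (_ * X ^ _)%N]card_ord.
apply: (@card_few_distinct _ _ g 5 3) => [p q|[? [? [? [? [? ?]]]]] //].
by move: p q => [? [? [? [? [? ?]]]]] [? [? [? [? [? ?]]]]] [-> -> -> -> -> ->].
Qed.

End GraphMomentBounds.

(** * Transfer to the planted model and asymptotics *)

Section Probability.
Variables (R : realType) (n : nat).
Implicit Types (G : graph n) (A : pred (graph n)) (K : {set 'I_n}).

Local Notation er := (@erdos_renyi R n 2^-1).

Lemma prob_predC A : prob er (predC A) = 1 - prob er A.
Proof.
have E : prob er A + prob er (predC A) = 1.
  rewrite -[RHS](mean1 R n) /mean [RHS](bigID A) /prob /=.
  by congr (_ + _); apply: eq_bigr => G _; rewrite mulr1.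
by rewrite -[X in X - _]E addrAC subrr add0r.
Qed.

Lemma le_prob A A' : (forall G, A G -> A' G) -> prob er A <= prob er A'.
Proof.
move=> AA'; rewrite /prob [leLHS]big_mkcond [leRHS]big_mkcond.
apply: ler_sum => G _; case: ifP => [/AA' -> //|_].
by case: ifP => // _; exact: erdos_renyi_half_ge0.
Qed.

Lemma prob_le1 A : prob er A <= 1.
Proof.
rewrite -subr_ge0 -prob_predC; apply: sumr_ge0 => G _.
exact: erdos_renyi_half_ge0.
Qed.

Lemma prob_not_and3 A B C :
  prob er (predC (fun G => [&& A G, B G & C G])) <=
  prob er (predC A) + (prob er (predC B) + prob er (predC C)).
Proof.
have probE D : prob er D = \sum_G (if D G then er G else 0).
  by rewrite /prob big_mkcond.
rewrite !probE -!big_split; apply: ler_sum => G _ /=.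
have := erdos_renyi_half_ge0 R G; set m := erdos_renyi _ _ => m0.
by case: (A G); case: (B G); case: (C G) => /=; lra.
Qed.

Definition clique_edges K : graph n := [set e : edge n | val e \subset K]%SET.

(** The planted law is the image of the uniform law under adding the edges inside [K]: each graph
    containing these edges has [2 ^ #|E|] preimages. *)
Lemma planted_on_half K G :
  planted_on (2^-1 : R) K G =
  \sum_(G0 : graph n | (G0 :|: clique_edges K)%SET == G) erdos_renyi 2^-1 G0.
Proof.
set E := clique_edges K.
have inE_E e : (e \in E) = (val e \subset K) by rewrite inE.
rewrite /planted_on (bigID (mem E)) /=.
rewrite (eq_bigr (fun e => (e \in G)%:R)); last by move=> e; rewrite inE_E => ->.
rewrite [X in _ * X](eq_bigr (fun _ => 2^-1)); last first.
  move=> e; rewrite inE_E => /negbTE ->; case: ifP => // _.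
  by field.
have sub (H H' : graph n) : H \subset H' -> forall e, (e \in H) ==> (e \in H').
  by move=> /fintype.subsetP HH' e; apply/implyP/HH'.
have [EG|EG] := boolP (E \subset G); last first.
  have [e eE eG] := subsetPn EG.
  rewrite (bigD1 e) //= (negbTE eG) !mul0r big_pred0 // => G0.
  by apply/negbTE; apply: contra EG => /eqP <-; exact: finset.subsetUr.
rewrite big1 => [|e eE]; last by rewrite (fintype.subsetP EG).
rewrite mul1r prodr_const.
rewrite (eq_bigr (fun _ => 2^-1 ^+ #|{: edge n}|)); last first.
  by move=> G0 _; rewrite erdos_renyi_half.
rewrite sumr_const.
have cardG0 : #|[pred G0 : graph n | (G0 :|: E)%SET == G]| = (2 ^ #|E|)%N.
  (* The preimages of [G] are the graphs [(G :\: E) :|: S] with [S] an arbitrary subset of [E]. *)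
  rewrite -card_powerset -(card_in_imset (f := fun S => (G :\: E) :|: S)%SET).
    apply: eq_card => G0; rewrite !inE; apply/eqP/imsetP => [<-|[S]] /=.
      exists (G0 :&: E)%SET; first by rewrite inE finset.subsetIr.
      apply/setP => e; rewrite !inE.
      by case: (e \in G0); case: (val e \subset K).
    rewrite inE => SE ->; apply/setP => e; rewrite !inE.
    move: (sub _ _ SE e) (sub _ _ EG e); rewrite inE_E.
    by case: (e \in S); case: (e \in G); case: (val e \subset K).
  move=> S S'; rewrite !inE => SE S'E /setP eqS; apply/setP => e.
  move: (eqS e) (sub _ _ SE e) (sub _ _ S'E e); rewrite !inE.
  by case: (e \in S); case: (e \in S'); case: (e \in G); case: (val e \subset K).
have cardCE : #|[pred e | e \notin E]| = (#|{: edge n}| - #|E|)%N.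
  by rewrite -(cardC (mem E)) addKn.
have EN : (#|E| <= #|{: edge n}|)%N by exact: max_card.
rewrite [X in _ ^+ X = _](_ : _ = (#|{: edge n}| - #|E|)%N); last exact: cardCE.
rewrite [X in _ = _ *+ X](_ : _ = (2 ^ #|E|)%N); last exact: cardG0.
rewrite -[RHS]mulr_natr natrX -[in RHS](subnK EN) exprD -mulrA -exprMn.
by rewrite mulVf ?expr1n ?mulr1.
Qed.

Lemma hidden_clique_prob (k : nat) A :
  prob (@hidden_clique R n 2^-1 k) A =
  \sum_(K : {set 'I_n} | #|K| == k)
    'C(n, k)%:R^-1 * prob er (fun G => A (G :|: clique_edges K)%SET).
Proof.
rewrite /prob /hidden_clique exchange_big; apply: eq_bigr => K _ /=.
rewrite -mulr_sumr; congr (_ * _).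
under [LHS]eq_bigr do rewrite planted_on_half.
rewrite [RHS](partition_big (fun G => G :|: clique_edges K)%SET A) //=.
apply: eq_bigr => G AG; apply: eq_bigl => G0.
by apply/idP/andP => [/eqP E|[]//]; rewrite E eqxx.
Qed.

Lemma sum_draws (k : nat) : (k <= n)%N ->
  \sum_(K : {set 'I_n} | #|K| == k) 'C(n, k)%:R^-1 = 1 :> R.
Proof.
move=> kn; rewrite sumr_const.
rewrite [X in _ *+ X = _](_ : _ = 'C(n, k)); last first.
  by rewrite -[in RHS](card_ord n) -card_draws; apply: eq_card => K; rewrite inE.
by rewrite -[LHS]mulr_natr mulVf // pnatr_eq0 -lt0n bin_gt0.
Qed.

Lemma hidden_clique_prob_le1 (k : nat) A : (k <= n)%N ->
  prob (@hidden_clique R n 2^-1 k) A <= 1.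
Proof.
move=> kn; rewrite hidden_clique_prob -[leRHS](sum_draws kn); apply: ler_sum => K _.
by rewrite ler_piMr ?invr_ge0 ?ler0n // prob_le1.
Qed.

(** For each [K] the planted graph contains the uniform graph it is built from. The condition
    [k <= n] makes the weights of the sets [K] sum to 1. *)
Lemma hidden_clique_prob_ge (k : nat) A A' : (k <= n)%N ->
  (forall G G', A G -> G \subset G' -> A' G') ->
  prob er A <= prob (@hidden_clique R n 2^-1 k) A'.
Proof.
move=> kn AA'; rewrite hidden_clique_prob -[leLHS]mul1r -[X in X * _](sum_draws kn) mulr_suml.
apply: ler_sum => K _; rewrite ler_wpM2l ?invr_ge0 ?ler0n //.
by apply: le_prob => G AG; apply: (AA' G) => //; exact: finset.subsetUl.
Qed.

End Probability.

(** Markov's inequality for each condition. With [t = kappa^3 n^2], the moments of order [n^4],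
    [n^8], [n^4] divided by the thresholds give multiples of [t^2], [t^4], [t^2], and [t^4 <= t^2]
    because [t <= 1]. *)
Lemma prob_not_pseudo_random (R : realType) (eps : R) : 0 < eps ->
  exists2 C : R, 0 <= C & forall n (kappa : R), 0 < kappa ->
    kappa ^+ 3 * n%:R ^+ 2 <= 1 ->
    prob (@erdos_renyi R n 2^-1) (predC (pseudo_random kappa eps)) <=
    C * (kappa ^+ 3 * n%:R ^+ 2) ^+ 2.
Proof.
move=> e0.
have [C1 C10 [A_le N_le]] : exists2 C : R, 0 <= C &
    (forall n, mean (fun G : graph n => cube_frob (sgn_adj R G)) <= C * n%:R ^+ 4) /\
    (forall n, mean (fun G : graph n => \sum_k \sum_(l | l != k)
      (\sum_i sgn_adj R G i k * sgn_adj R G i l) ^+ 4) <= C * n%:R ^+ 4).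
  exists (4 ^ 6)%N%:R; first exact: ler0n.
  split=> n; rewrite -natrX -natrM; first exact: mean_frob_sgn_adj.
  exact: mean_codegree.
have [C2 C20 M_le] : exists2 C : R, 0 <= C & forall n,
    mean (fun G : graph n => cube_frob (cycle_mx (sgn_adj R G))) <= C * n%:R ^+ 8.
  exists (8 ^ 12)%N%:R; first exact: ler0n.
  move=> n; rewrite -natrX -natrM; exact: mean_frob_cycle_mx.
have e60 : 0 < eps ^+ 6 by rewrite exprn_gt0.
have e40 : 0 < eps ^+ 4 by rewrite exprn_gt0.
exists (C1 / eps ^+ 6 + (C2 / eps ^+ 6 + 4 * C1 / eps ^+ 4)).
  by do 2?apply: addr_ge0; apply: divr_ge0; rewrite ?mulr_ge0 ?ler0n // ltW.
move=> n kappa k0; set t := kappa ^+ 3 * _ => t1.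
have t0 : 0 <= t by rewrite mulr_ge0 ?exprn_ge0 ?ler0n ?(ltW k0).
have kN0 : kappa != 0 by rewrite gt_eqF.
have eN0 : eps != 0 by rewrite gt_eqF.
have t4 : t ^+ 4 <= t ^+ 2.
  by rewrite -[leRHS]mul1r (exprD t 2 2) ler_wpM2r ?exprn_ge0 // exprn_ile1.
have frob_ge0 (T : finType) (K : T -> T -> R) : 0 <= cube_frob K.
  by apply: sumr_ge0 => i _; exact: sum_sqr_ge0.
apply: (le_trans (prob_not_and3 R _ _ _)).
rewrite [leRHS]mulrDl [X in _ <= _ + X]mulrDl.
apply: lerD; last apply: lerD.
- have c0 : 0 < (eps / kappa) ^+ 6 by rewrite exprn_gt0 // divr_gt0.
  apply: (le_trans (markov c0 (fun G => frob_ge0 _ (sgn_adj R G)))).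
  rewrite ler_pdivrMr //; apply: (le_trans (A_le n)).
  rewrite le_eqVlt; apply/orP; left; apply/eqP; rewrite /t.
  by field; apply/andP.
- have c0 : 0 < (eps / kappa ^+ 2) ^+ 6 by rewrite exprn_gt0 // divr_gt0 // exprn_gt0.
  apply: (le_trans (markov c0 (fun G => frob_ge0 _ (cycle_mx (sgn_adj R G))))).
  apply: (@le_trans _ _ (C2 / eps ^+ 6 * t ^+ 4)); last first.
    by rewrite ler_wpM2l // divr_ge0 // ltW.
  rewrite ler_pdivrMr //; apply: (le_trans (M_le n)).
  rewrite le_eqVlt; apply/orP; left; apply/eqP; rewrite /t.
  by field; apply/andP.
- have c0 : 0 < (eps ^+ 2 / (2 * kappa ^+ 3)) ^+ 2.
    by rewrite exprn_gt0 // divr_gt0 ?mulr_gt0 ?exprn_gt0 ?ltr0n.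
  pose N4 (G : graph n) := \sum_k \sum_(l | l != k)
    (\sum_i sgn_adj R G i k * sgn_adj R G i l) ^+ 4.
  have N_ge0 G : 0 <= N4 G.
    apply: sumr_ge0 => k _; apply: sumr_ge0 => l _.
    by rewrite (exprM _ 2 2) sqr_ge0.
  apply: (@le_trans _ _ (mean N4 / (eps ^+ 2 / (2 * kappa ^+ 3)) ^+ 2)).
    exact: markov c0 N_ge0.
  rewrite ler_pdivrMr //; apply: (le_trans (N_le n)).
  rewrite le_eqVlt; apply/orP; left; apply/eqP; rewrite /t.
  by field; apply/andP.
Qed.

Lemma cube_root_cube (R : realType) (n : nat) : (n%:R `^ (3%:R^-1)) ^+ 3 = n%:R :> R.
Proof.
by rewrite -powR_mulrn ?powR_ge0 // -powRrM mulVf ?pnatr_eq0 // powRr1.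
Qed.

Lemma ln_natr_near (R : realType) (M : R) :
  \forall n \near \oo, M <= ln (n%:R : R).
Proof.
near=> n; rewrite -[leLHS]expRK ler_ln ?posrE ?expR_gt0 //.
  by near: n; exact: nbhs_infty_ger.
apply: (lt_le_trans (expR_gt0 M)).
by near: n; exact: nbhs_infty_ger.
Unshelve. all: by end_near. Qed.

(* With n = r^3 and kappa = 1 / (r^2 ln n), the objective is n kappa = r / ln n
   and the failure parameter kappa^3 n^2 equals (ln n)^-3. *)
Lemma sos4_test_whp (R : realType) (c c1 : R) (k : nat -> nat) :
  0 < c -> 0 < c1 -> c1 <= 1 -> c * c1 < 1 ->
  (\forall n \near \oo,
     (1 <= k n)%N /\
     (k n)%:R <= c1 * (n%:R `^ (3%:R^-1)) / ln (n%:R : R)) ->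
  forall e : R, 0 < e -> \forall n \near \oo, (k n <= n)%N /\
  exists2 A : pred (graph n),
    1 - e <= prob (@erdos_renyi R n 2^-1) A &
    forall G G' : graph n, A G -> G \subset G' -> sos4_test c (k n) G'.
Proof.
move=> c0 c10 c11 cc1 hk e e_gt0.
have small (a : R) : 0 < a -> exists2 eps : R, 0 < eps & a * eps <= 1.
  by move=> a0; exists a^-1; rewrite ?invr_gt0 // divff // gt_eqF.
have [eps eps0 eps1] := small (100 * 1000) (mulr_gt0 (ltr0Sn R 99) (ltr0Sn R 999)).
have [C C0 bad] := prob_not_pseudo_random eps0.
near=> n.
have [k1 kn] : (1 <= k n)%N /\ (k n)%:R <= c1 * (n%:R `^ (3%:R^-1)) / ln (n%:R : R).
  by near: n.
have L1 : 1 <= ln (n%:R : R) by near: n; exact: ln_natr_near.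
(* The next three thresholds serve, in order, the smallness of [kappa], the bound on [n^2] required
   for feasibility, and a failure probability of at most [e]. *)
have Lk : 100 * 100 <= ln (n%:R : R) by near: n; exact: ln_natr_near.
have Le : 2 / eps ^+ 2 <= ln (n%:R : R) by near: n; exact: ln_natr_near.
have LC : C / e <= ln (n%:R : R) by near: n; exact: ln_natr_near.
have n0 : 0 < n%:R :> R.
  (* The convention [ln 0 = 0] contradicts [1 <= ln n], which excludes [n = 0]. *)
  rewrite lt0r ler0n andbT; apply: contraTN L1 => /eqP ->.
  by rewrite ln0 // -ltNge.
have n1 : 1 <= n%:R :> R by rewrite ler1n -(ltr0n R).
move: kn; have := cube_root_cube R n; have := powR_gt0 3%:R^-1 n0.
set r := n%:R `^ _; set L := ln _ in L1 Lk Le LC * => r0 r3 kn.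
have r1 : 1 <= r.
  rewrite leNgt; apply/negP => r_lt1; move: n1; rewrite -r3 leNgt => /negP; apply.
  by rewrite exprn_ilt1 // ltW.
have rn : r <= n%:R.
  by rewrite -r3 exprS ler_peMr ?(ltW r0) // exprn_ege1.
have L0 : 0 < L by apply: lt_le_trans L1.
have rN0 : r != 0 by rewrite gt_eqF.
have LN0 : L != 0 by rewrite gt_eqF.
pose kappa := (r ^+ 2 * L)^-1.
have k0 : 0 < kappa by rewrite invr_gt0 mulr_gt0 ?exprn_gt0.
have nk : n%:R * kappa = r / L by rewrite -r3 /kappa; field; apply/andP.
have tE : kappa ^+ 3 * n%:R ^+ 2 = L^-1 ^+ 3 by rewrite -r3 /kappa; field; apply/andP.
have Li0 : 0 <= L^-1 by rewrite invr_ge0 ltW.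
have Li1 : L^-1 <= 1 by rewrite invf_le1.
have k_small : 100 * 100 * kappa <= 1.
  rewrite /kappa ler_pdivrMr ?mulr_gt0 ?exprn_gt0 // mul1r; apply: (le_trans Lk).
  by rewrite ler_peMl ?(ltW L0) // exprn_ege1.
have n_small : n%:R ^+ 2 <= eps ^+ 2 / (2 * kappa ^+ 3).
  rewrite ler_pdivlMr ?mulr_gt0 ?ltr0n ?exprn_gt0 //.
  have -> : n%:R ^+ 2 * (2 * kappa ^+ 3) = 2 * (kappa ^+ 3 * n%:R ^+ 2) by ring.
  rewrite tE; apply: (@le_trans _ _ (2 * L^-1)).
    by rewrite ler_pM2l ?ltr0n // exprS ler_piMr // exprn_ile1.
  move: Le; rewrite ler_pdivrMr ?exprn_gt0 // => Le.
  by rewrite ler_pdivrMr // mulrC.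
have t1 : kappa ^+ 3 * n%:R ^+ 2 <= 1 by rewrite tE exprn_ile1.
split.
  (* Here [k <= c1 r / L <= r <= n], so the hidden clique law is a genuine probability. *)
  rewrite -(ler_nat R); apply: (le_trans kn); rewrite -/r -/L.
  rewrite ler_pdivrMr // mulrC; apply: ler_pM => //; [exact: ltW|exact: ltW|].
  exact: le_trans L1.
exists (pseudo_random kappa eps).
  have := bad n kappa k0 t1; rewrite prob_predC tE => b.
  have : C * (L^-1 ^+ 3) ^+ 2 <= e.
    apply: (@le_trans _ _ (C * L^-1)).
      by rewrite ler_wpM2l // -exprM exprS ler_piMr // exprn_ile1.
    by rewrite ler_pdivrMr // mulrC -ler_pdivrMr.
  by move: b; lra.
move=> G G' prG GG'.
have feas := sos4_feasible_mono GG' (moment_mx_feasible k0 k_small eps0 eps1 n_small prG).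
rewrite /sos4_test; apply: lt_le_trans (Val4_ge feas).
rewrite moment_mx_objective nk.
(* The objective is [r / L], and [c k <= c c1 r / L < r / L] because [c * c1 < 1]. *)
apply: (@le_lt_trans _ _ (c * (c1 * r / L))); first by rewrite ler_pM2l.
by rewrite !mulrA -(mulrA _ r) gtr_pMl ?divr_gt0.
Unshelve. all: by end_near. Qed.
Theorem theorem2 (R : realType) (c_star : R) (c_star_gt0 : 0 < c_star) :
  exists2 c1 : R, 0 < c1 &
  forall k : nat -> nat,
  (\forall n \near \oo,
     (1 <= k n)%N /\
     (k n)%:R <= c1 * (n%:R `^ (3%:R^-1)) / ln (n%:R : R)) ->
  [/\ prob (@erdos_renyi R n 2%:R^-1) (@sos4_test R c_star (k n) n)
        @[n --> \oo] --> (1 : R),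
      prob (@hidden_clique R n 2%:R^-1 (k n)) (@sos4_test R c_star (k n) n)
        @[n --> \oo] --> (1 : R)
    & ~ distinguishes_whp (2%:R^-1 : R) k
          (fun n => @sos4_test R c_star (k n) n)].
Proof.
(* This choice of [c1] gives both [c1 <= 1], used for [k <= n], and [c_star * c1 < 1], used for the
   strict test inequality. *)
have c1_gt0 : 0 < (2 * c_star + 1)^-1 by rewrite invr_gt0; lra.
have c1_le1 : (2 * c_star + 1)^-1 <= 1 by rewrite invf_le1; lra.
have cc1 : c_star * (2 * c_star + 1)^-1 < 1 by rewrite ltr_pdivrMr; lra.
exists (2 * c_star + 1)^-1 => // k hk.
have whp := sos4_test_whp c_star_gt0 c1_gt0 c1_le1 cc1 hk.
have er1 : prob (@erdos_renyi R n 2%:R^-1) (@sos4_test R c_star (k n) n)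
    @[n --> \oo] --> (1 : R).
  apply/cvgrPdist_le => e e0; near=> n.
  have [_ [A A_ge A_test]] : (k n <= n)%N /\ exists2 A : pred (graph n),
      1 - e <= prob (@erdos_renyi R n 2^-1) A &
      forall G G' : graph n, A G -> G \subset G' -> sos4_test c_star (k n) G'.
    by near: n; exact: whp.
  have A_le : prob (@erdos_renyi R n 2^-1) A <=
      prob (@erdos_renyi R n 2^-1) (@sos4_test R c_star (k n) n).
    by apply: le_prob => G AG; apply: (A_test G) => //; exact: fintype.subxx.
  rewrite ger0_norm ?subr_ge0 ?prob_le1 //.
  by move: A_ge A_le; lra.
have hc1 : prob (@hidden_clique R n 2%:R^-1 (k n)) (@sos4_test R c_star (k n) n)
    @[n --> \oo] --> (1 : R).
  apply/cvgrPdist_le => e e0; near=> n.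
  have [kn [A A_ge A_test]] : (k n <= n)%N /\ exists2 A : pred (graph n),
      1 - e <= prob (@erdos_renyi R n 2^-1) A &
      forall G G' : graph n, A G -> G \subset G' -> sos4_test c_star (k n) G'.
    by near: n; exact: whp.
  have A_le := hidden_clique_prob_ge R kn A_test.
  rewrite ger0_norm ?subr_ge0 ?hidden_clique_prob_le1 //.
  by move: A_ge A_le; lra.
(* Distinguishing would make the acceptance probability under the uniform model tend to 0, whereas
   it tends to 1. *)
split=> // -[er0 _].
have : (1 : R) = 0 by exact: (cvg_unique _ er1 er0).
by move/eqP; rewrite oner_eq0.
Unshelve. all: by end_near. Qed.
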